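(* Let $p$ be a positive integer or $p=\infty$, let $p_j$ be a positive integer, and let $\widehat{\lambda}_j\in\mathbb{C}$, $Q_j\in\mathbb{C}^{p_j\times p_j}$ and $R_j\in\mathbb{R}_+^{p_j\times p_j}$. Suppose $\mathrm{Re}(\widehat{\lambda}_j)-\|R_j\|_p>0$ and $|Q_j|\le R_j$, and define $$\delta_p:=\|R_j\|_p\Bigl(\Gamma^{(1)}\bigl(\mathrm{Re}(\widehat{\lambda}_j)+\|R_j\|_p\bigr)+\omega\bigl(\mathrm{Re}(\widehat{\lambda}_j)+\|R_j\|_p\bigr)+\omega\bigl(\mathrm{Re}(\widehat{\lambda}_j)-\|R_j\|_p\bigr)\Bigr).$$ Then $\|\Gamma(\widehat{\lambda}_jI_{p_j}+Q_j)-\Gamma(\widehat{\lambda}_jI_{p_j})\|_p<\delta_p$.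
   Context: $\mathbb{R}_+^{k\times k}$ is the set of real $k\times k$ matrices with all entries nonnegative. $\|\cdot\|_p$ is the operator norm on matrices induced by the vector $p$-norm. $|Q_j|$ is the entrywise modulus, and inequalities between real matrices are entrywise. $I_k$ is the $k\times k$ identity matrix. For real $\alpha>0$, $\omega(\alpha):=\dfrac{2\alpha+1}{\alpha^2(\alpha+1)^2}+\dfrac{\cosh(1)-1}{(\alpha+2)^2}$. $\Gamma^{(1)}$ is the first derivative of the scalar gamma function. For a square complex matrix $B$ with no eigenvalue in $\{z\in\mathbb{Z}:z\le 0\}$, $\Gamma(B)$ is the matrix gamma function, i.e. the primary matrix function associated with the scalar function $\Gamma$; when all eigenvalues of $B\in\mathbb{C}^{k\times k}$ have positive real part, $\Gamma(B)=\int_0^\infty e^{-t}t^{B-I_k}\,dt$ with $t^{B-I_k}:=e^{(B-I_k)\log t}$.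
   Formalization: The formal statement adds the hypothesis that R_j is not the zero matrix: for R_j = 0 one has Q_j = 0 and δ_p = 0, so the strict inequality as printed would read 0 < 0 and fails. *)

(* Defs.v *)
From HB Require Import structures.
From mathcomp Require Import all_boot all_order all_algebra.
From mathcomp Require Import complex.
From mathcomp Require Import all_classical all_reals all_analysis.

Set Implicit Arguments.
Unset Strict Implicit.
Unset Printing Implicit Defensive.

Import Order.TTheory GRing.Theory Num.Theory.
Import numFieldNormedType.Exports.

Local Open Scope classical_set_scope.
Local Open Scope ring_scope.
Local Open Scope complex_scope.

Section Norms.
Variable R : realType.

Definition cabs (z : R[i]) : R := Normc.normc z.

(* The exponent [Some q] is the integer q, and [None] is infinity. *)
Definition vnorm (p : option nat) (n : nat) (x : 'cV[R[i]]_n) : R :=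
  if p is Some q then (\sum_(i < n) cabs (x i 0) ^+ q) `^ (q%:R^-1)
  else \big[Num.max/0]_(i < n) cabs (x i 0).

Definition opnorm (p : option nat) (n : nat) (A : 'M[R[i]]_n) : R :=
  sup [set vnorm p (A *m x) / vnorm p x | x in [set x : 'cV[R[i]]_n | x != 0]].

(* A real matrix is normed through its action on complex vectors. *)
Definition opnormR (p : option nat) (n : nat) (A : 'M[R]_n) : R :=
  opnorm p (map_mx (real_complex R) A).

End Norms.

Section Gamma.
Variable R : realType.

Definition cexp (z : R[i]) : R[i] :=
  (expR (complex.Re z) * cos (complex.Im z)) +i*
  (expR (complex.Re z) * sin (complex.Im z)).

Definition gamma_integrand (z : R[i]) (t : R) : R[i] :=
  (expR (- t))%:C * cexp ((z - 1) * (ln t)%:C).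

(* Meaningful only for Re z > 0. *)
Definition euler_integral (z : R[i]) : R[i] :=
  (\int[lebesgue_measure]_(t in `]0, +oo[) complex.Re (gamma_integrand z t)) +i*
  (\int[lebesgue_measure]_(t in `]0, +oo[) complex.Im (gamma_integrand z t)).

(* Analytic continuation by Gamma z = Gamma (z + m) / (z (z + 1) ... (z + m - 1)),
   where m is large enough that Re (z + m) > 0; its value at the poles is 0. *)
Definition cGamma (z : R[i]) : R[i] :=
  let m := if 0 < complex.Re z then 0%N else (Num.truncn (- complex.Re z)).+1 in
  euler_integral (z + m%:R) / \prod_(i < m) (z + i%:R).

(* The j-th derivative is the complex one: the limit of the difference quotients
   is taken along all h -> 0 in R[i]. *)
Definition cderiv (f : R[i] -> R[i]) (j : nat) : R[i] -> R[i] :=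
  derive1n j (f : R[i] -> R[i]^o).

(* The derivative of Gamma at a real point, which is real away from the poles. *)
Definition Gamma1 (x : R) : R := complex.Re (cderiv cGamma 1 x%:C).

End Gamma.

Section MatrixFunction.
Variables (R : realType) (n : nat).
Implicit Types (f : R[i] -> R[i]) (A : 'M[R[i]]_n.+1).

(* [mup x (mxminpoly A)] is the size of the largest Jordan block of A at x, and
   is 0 when x is not an eigenvalue. *)
Definition hermite_interpolant f A (q : {poly R[i]}) : Prop :=
  (size q < size (mxminpoly A))%N /\
  forall (x : R[i]) (j : nat), (j < mup x (mxminpoly A))%N ->
    (derivn j q).[x] = cderiv f j x.

(* The primary matrix function of f: the value at A of the Hermite interpolant
   of f on the spectrum of A, which exists and is unique. *)
Definition primary_matrix_function f A : 'M[R[i]]_n.+1 :=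
  horner_mx A (xget 0 [set q | hermite_interpolant f A q]).

Definition mxGamma A := primary_matrix_function (@cGamma R) A.

End MatrixFunction.

Section Bound.
Variable R : realType.

Definition cosh1 : R := (expR 1 + expR (- 1)) / 2.

Definition omega (a : R) : R :=
  (2 * a + 1) / (a ^+ 2 * (a + 1) ^+ 2) + (cosh1 - 1) / (a + 2) ^+ 2.

(* a = Re lambda and r is the norm of the radius matrix. *)
Definition delta (a r : R) : R :=
  r * (Gamma1 (a + r) + omega (a + r) + omega (a - r)).

End Bound.

(* Main.v *)
Require Import Defs.
From mathcomp Require Import all_boot all_order all_algebra.
From mathcomp Require Import complex.
From mathcomp Require Import all_classical all_reals all_analysis.
From mathcomp Require Import ring lra measurable_realfun.

(** Write [a] for the real part of [lambda] and [r] for the norm of the radius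
    matrix.  Since the norm of a complex vector depends only on the moduli of its
    entries, [Q] has operator norm at most [r] ([vnorm_dominated]); in particular
    the spectrum of [lambda + Q] lies in the closed disc of radius [r] about
    [lambda], inside the half-plane where Euler's integral converges.

    Differentiating under the integral sign, the [k]-th derivative of the gamma
    function at [z] is the moment [gmoment k z], the integral of
    [expR (- t) * t ^ (z - 1) * (ln t) ^ k] ([cderiv_cGamma]).  Both this fact and
    the convergence of the Taylor series in the disc of radius [a] about [lambda]
    follow from a single estimate, [gmoment_taylor]: the integrand is expanded
    with [cexp_remainder], whose remainder [rho ^ M * expR (|w| / rho)] stays
    integrable as long as the dilated exponent is below the abscissa.

    Dividing a polynomial by the minimal polynomial writes its value at a matrix
    in terms of its jets on the spectrum ([horner_mx_hermite]).  The jets of the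
    Taylor polynomials of the gamma function converge to those of the Hermite
    interpolant, hence [mxGamma (lambda + Q)] is the limit of the Taylor
    polynomials evaluated at [lambda + Q], and any bound on the latter passes to
    the limit ([mxGamma_le]).  By the triangle inequality (Minkowski, [vnormD])
    the difference of the two matrix values has norm at most
    the sum over [k >= 1] of [|gmoment k lambda| r ^ k / k!], and therefore at most
    the integral of [expR (- t) t ^ (a - 1)] times [expR (r |ln t|) - 1].

    Finally [expR u - 1 <= u * expR u] bounds this by [r] times the integral of
    [expR (- t) t ^ (a - 1) |ln t| expR (r |ln t|)].  For [t > 1] the integrand is
    that of the derivative of the gamma function at [a + r]; for [t <= 1] the
    weight [expR (- t)] is at most [1 - t + t ^ 2 / 2], and the resulting
    logarithmic moments have explicit bounds ([integral_log_majorant]).  The inequality is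
    strict because the coefficient [1 / 2] is smaller than [cosh 1 - 1]
    ([log_moment_lt_omega]). *)

Set Implicit Arguments.
Unset Strict Implicit.
Unset Printing Implicit Defensive.

Import Order.TTheory GRing.Theory Num.Theory.
Import numFieldNormedType.Exports.

Local Open Scope ring_scope.

(** * Hermite interpolation *)

Section Hermite.
Variable F : numFieldType.
Implicit Types (p q w : {poly F}) (rs : seq F).

Lemma derivn_mulXsubC_exp m w (z : F) j : (j <= m)%N ->
  ((w * ('X - z%:P) ^+ m)^`(j)).[z] = if (j < m)%N then 0 else m`!%:R * w.[z].
Proof.
elim: m w j => [|m IH] w [|j] // jm.
- by rewrite derivn0 expr0 mulr1 mul1r.
- by rewrite derivn0 !hornerE /= subrr exprS mul0r mulr0.
rewrite derivSn.
have -> : (w * ('X - z%:P) ^+ m.+1)^`() =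
    (w^`() * ('X - z%:P) + m.+1%:R *: w) * ('X - z%:P) ^+ m.
  rewrite derivM deriv_exp derivXsubC mul1r /= exprS.
  by rewrite -[_ *+ _]mulr_natl -mul_polyC polyCMn; ring.
rewrite IH // !hornerE subrr mulr0 add0r ltnS; case: ifP => // _.
by rewrite factS natrM; ring.
Qed.

Lemma split_roots (z : F) rs : exists2 w, w.[z] != 0 &
  \prod_(x <- rs) ('X - x%:P) = w * ('X - z%:P) ^+ count_mem z rs.
Proof.
elim: rs => [|x rs [w wz IH]].
  by exists 1; rewrite ?hornerC ?oner_neq0 // big_nil mulr1.
rewrite big_cons IH /=; case: eqVneq => [->|xz].
  by exists w => //; rewrite add1n exprS; ring.
exists (('X - x%:P) * w); last by rewrite add0n mulrA.
by rewrite !hornerE mulf_neq0 // subr_eq0 eq_sym.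
Qed.

(** Prepending [z] to the list of roots raises its multiplicity by one. Below the
    new multiplicities, the derivatives of a multiple of the old product all
    vanish but one, which is a nonzero multiple of the cofactor at [z]. *)
Lemma derivn_split_roots (z x : F) p rs j : (j < count_mem x (z :: rs))%N ->
  exists2 c, c != 0 & ((p * \prod_(y <- rs) ('X - y%:P))^`(j)).[x] =
    if (x == z) && (j == count_mem z rs) then c * p.[z] else 0.
Proof.
have [w wx ->] := split_roots x rs; rewrite /= mulrA => jx.
exists ((count_mem x rs)`!%:R * w.[x]).
  by rewrite mulf_neq0 // pnatr_eq0 -lt0n fact_gt0.
rewrite derivn_mulXsubC_exp; last first.
  by move: jx => /=; case: (z == x) => //; rewrite add0n => /ltnW.
move: jx => /=; rewrite eq_sym; case: eqVneq => [<-|xz] /=; last by rewrite add0n => ->.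
by rewrite add1n ltnS leq_eqVlt; case: ltngtP => //= _ _; rewrite hornerM; ring.
Qed.

(** The Newton form of the interpolant is built root by root. *)
Lemma hermite_exists rs (d : F -> nat -> F) : exists2 q : {poly F}, (size q <= size rs)%N &
  forall x j, (j < count_mem x rs)%N -> (q^`(j)).[x] = d x j.
Proof.
elim: rs => [|z rs [q sq IH]]; first by exists 0; rewrite ?size_poly0.
set m := count_mem z rs; set P := \prod_(y <- rs) ('X - y%:P).
have mz : (m < count_mem z (z :: rs))%N by rewrite /= eqxx.
have [c c0 cE] := derivn_split_roots 1 mz.
pose e := (d z m - (q^`(m)).[z]) / c.
exists (q + e%:P * P).
  rewrite (leq_trans (size_polyD _ _)) // geq_max ltnW //=.
  by rewrite mul_polyC (leq_trans (size_scale_leq _ _)) // size_prod_XsubC.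
move=> x j jx; rewrite mul_polyC derivnD derivnZ hornerD hornerZ -[P]mul1r.
case: (boolP ((x == z) && (j == m))) => [/andP[/eqP -> /eqP ->]|xzj].
  by rewrite cE !eqxx hornerC mulr1 /e divfK // addrC subrK.
have [c' _ ->] := derivn_split_roots 1 jx.
rewrite (negbTE xzj) mulr0 addr0 IH //.
move: jx xzj => /=; rewrite eq_sym; case: eqVneq => [->|] //=.
by rewrite add1n ltnS leq_eqVlt; case: eqVneq.
Qed.

Lemma hermite_unique rs p :
  (forall x j, (j < count_mem x rs)%N -> (p^`(j)).[x] = 0) ->
  \prod_(y <- rs) ('X - y%:P) %| p.
Proof.
elim: rs => [|z rs IH] H; first by rewrite big_nil dvd1p.
have /dvdpP [u pE] : \prod_(y <- rs) ('X - y%:P) %| p.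
  by apply: IH => x j jx; apply: H => /=; rewrite ltn_addl.
have mz : (count_mem z rs < count_mem z (z :: rs))%N by rewrite /= eqxx.
have [c c0 cE] := derivn_split_roots u mz.
move: (H _ _ mz); rewrite pE cE !eqxx /= => /eqP.
rewrite mulf_eq0 (negbTE c0) /= -/(root u z) root_factor_theorem => uz.
by rewrite big_cons dvdp_mul.
Qed.

Lemma mup_prod_XsubC (x : F) rs :
  mup x (\prod_(y <- rs) ('X - y%:P)) = count_mem x rs.
Proof.
have [w wx ->] := split_roots x rs.
by rewrite mupMr ?mup_XsubCX ?eqxx // /root.
Qed.

(** Dividing by the annihilating product leaves only the jets at the roots, so
    that small jets force a small value at [A]. *)
Lemma horner_mx_hermite n (A : 'M[F]_n.+1) rs (H : F -> nat -> {poly F}) p :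
  horner_mx A (\prod_(y <- rs) ('X - y%:P)) = 0 ->
  (forall y k x j, (j < count_mem x rs)%N ->
     ((H y k)^`(j)).[x] = ((x == y) && (j == k))%:R) ->
  horner_mx A p = \sum_(y <- undup rs) \sum_(k < count_mem y rs)
     (p^`(k)).[y] *: horner_mx A (H y k).
Proof.
move=> PA HE.
set q := \sum_(y <- undup rs) \sum_(k < count_mem y rs) (p^`(k)).[y] *: H y k.
have /dvdpP[u pqE] : \prod_(y <- rs) ('X - y%:P) %| p - q.
  apply: hermite_unique => x j jx.
  have xrs : x \in undup rs by rewrite mem_undup -has_pred1 has_count (leq_trans _ jx).
  rewrite derivnB hornerD hornerN; apply/eqP; rewrite subr_eq0; apply/eqP.
  rewrite /q raddf_sum horner_sum (big_rem x) //=.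
  rewrite raddf_sum horner_sum (bigD1 (Ordinal jx)) //= derivnZ hornerZ HE //.
  rewrite !eqxx mulr1 big1 ?addr0 => [|k kj]; last first.
    rewrite derivnZ hornerZ HE // eqxx /= eq_sym.
    by move: kj; rewrite -val_eqE /= => /negbTE ->; rewrite mulr0.
  rewrite big_seq big1 ?addr0 // => y.
  rewrite (mem_rem_uniq _ (undup_uniq _)) inE eq_sym => /andP[xy _].
  rewrite raddf_sum horner_sum big1 // => k _ /=.
  by rewrite derivnZ hornerZ HE // (negbTE xy) mulr0.
have -> : horner_mx A p = horner_mx A q.
  by apply/eqP; rewrite -subr_eq0 -rmorphB pqE rmorphM /= PA mulr0.
rewrite /q rmorph_sum /=.
apply: eq_bigr => y _; rewrite rmorph_sum; apply: eq_bigr => k _ /=.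
by rewrite -mul_polyC rmorphM /= horner_mx_C -mul_scalar_mx.
Qed.

Lemma hermite_basis rs : exists H : F -> nat -> {poly F}, forall y k x j,
  (j < count_mem x rs)%N -> ((H y k)^`(j)).[x] = ((x == y) && (j == k))%:R.
Proof.
have /choice[H HE] : forall yk : F * nat, exists q : {poly F}, forall x j,
    (j < count_mem x rs)%N -> (q^`(j)).[x] = ((x == yk.1) && (j == yk.2))%:R.
  move=> [y k]; have [q _ qE] := hermite_exists rs (fun x j => ((x == y) && (j == k))%:R).
  by exists q.
by exists (fun y k => H (y, k)) => y k; exact: HE.
Qed.

End Hermite.

(** * Vector and operator norms *)

Section ComplexModulus.
Variable R : realType.
Implicit Types z w : complex R.

Lemma cabs_ge0 z : 0 <= cabs z. Proof. by case: z => a b; exact: sqrtr_ge0. Qed.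
Lemma cabsM z w : cabs (z * w) = cabs z * cabs w. Proof. exact: Normc.normcM. Qed.
Lemma cabsD z w : cabs (z + w) <= cabs z + cabs w. Proof. exact: le_normcD. Qed.
Lemma cabsN z : cabs (- z) = cabs z. Proof. exact: normcN. Qed.
Lemma cabs0 : cabs (0 : complex R) = 0. Proof. exact: Normc.normc0. Qed.
Lemma cabs1 : cabs (1 : complex R) = 1. Proof. exact: Normc.normc1. Qed.
Lemma cabs_eq0 z : (cabs z == 0) = (z == 0).
Proof. by apply/eqP/eqP => [/Normc.eq0_normc|->] //; exact: cabs0. Qed.
Lemma cabs_gt0 z : (0 < cabs z) = (z != 0).
Proof. by rewrite lt_def cabs_ge0 andbT cabs_eq0. Qed.

Lemma cabsX z k : cabs (z ^+ k) = cabs z ^+ k.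
Proof. by elim: k => [|k IH]; rewrite ?cabs1 // !exprS cabsM IH. Qed.

Lemma cabs_real (x : R) : cabs x%:C%C = `|x|.
Proof. by rewrite /cabs /= expr0n /= addr0 sqrtr_sqr. Qed.

Lemma cabs_sum (I : Type) (r : seq I) (P : pred I) (f : I -> complex R) :
  cabs (\sum_(i <- r | P i) f i) <= \sum_(i <- r | P i) cabs (f i).
Proof.
elim/big_ind2: _ => [|a b c d ab cd|//]; first by rewrite cabs0.
exact: le_trans (cabsD _ _) (lerD ab cd).
Qed.

Lemma normr_Re_cabs z : `|complex.Re z| <= cabs z.
Proof. by case: z => a b; rewrite /cabs /= -sqrtr_sqr ler_wsqrtr // lerDl sqr_ge0. Qed.

Lemma normr_Im_cabs z : `|complex.Im z| <= cabs z.
Proof. by case: z => a b; rewrite /cabs /= -sqrtr_sqr ler_wsqrtr // lerDr sqr_ge0. Qed.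

End ComplexModulus.

Section VectorNorm.
Variable R : realType.
Local Notation C := (complex R).

Lemma vnorm_ge0 p n (x : 'cV[C]_n) : 0 <= vnorm p x.
Proof.
rewrite /vnorm; case: p => [q|]; first exact: powR_ge0.
by elim/big_ind: _ => // [a b a0 b0|i _]; rewrite ?cabs_ge0 // le_max a0.
Qed.

Lemma sum_cabsX n (x : 'cV[C]_n) q : (0 < q)%N ->
  \sum_(i < n) cabs (x i 0) ^+ q = vnorm (Some q) x ^+ q.
Proof.
move=> q0; rewrite /vnorm -powR_mulrn ?powR_ge0 // -powRrM mulVf ?powRr1 //.
  by apply: sumr_ge0 => i _; rewrite exprn_ge0 ?cabs_ge0.
by rewrite pnatr_eq0 -lt0n.
Qed.

Lemma vnorm_le n (x : 'cV[C]_n) q c : (0 < q)%N -> 0 <= c ->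
  \sum_(i < n) cabs (x i 0) ^+ q <= c ^+ q -> vnorm (Some q) x <= c.
Proof.
by move=> q0 c0; rewrite sum_cabsX // ler_pXn2r // nnegrE //; exact: vnorm_ge0.
Qed.

Variable p : option nat.
Hypothesis hp : p <> Some 0%N.

Lemma le_vnorm n (x y : 'cV[C]_n) :
  (forall i, cabs (x i 0) <= cabs (y i 0)) -> vnorm p x <= vnorm p y.
Proof.
move: hp; case: p => [[//|q] _|_] xy; last exact: le_bigmax2.
apply: vnorm_le => //; first by exact: powR_ge0.
rewrite -sum_cabsX //; apply: ler_sum => i _.
by rewrite lerXn2r ?nnegrE ?cabs_ge0.
Qed.

Lemma vnorm_cabs n (x y : 'cV[C]_n) :
  (forall i, cabs (x i 0) = cabs (y i 0)) -> vnorm p x = vnorm p y.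
Proof. by move=> xy; apply/le_anti; rewrite !le_vnorm // => i; rewrite xy. Qed.

Lemma vnormZ n (c : C) (x : 'cV[C]_n) : vnorm p (c *: x) = cabs c * vnorm p x.
Proof.
rewrite /vnorm; case: p hp => [[//|q] _|_].
  rewrite (eq_bigr (fun i => cabs c ^+ q.+1 * cabs (x i 0) ^+ q.+1)); last first.
    by move=> i _; rewrite mxE cabsM exprMn.
  rewrite -mulr_sumr powRM ?exprn_ge0 ?cabs_ge0 //; last first.
    by apply: sumr_ge0 => i _; rewrite exprn_ge0 ?cabs_ge0.
  rewrite -powR_mulrn ?cabs_ge0 // -powRrM mulfV ?pnatr_eq0 //.
  by rewrite powRr1 ?cabs_ge0.
elim/big_ind2: _ => [|a b d e -> ->|i _]; rewrite ?mulr0 //.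
  by rewrite maxr_pMr ?cabs_ge0.
by rewrite mxE cabsM.
Qed.

Lemma cabs_le_vnorm n (x : 'cV[C]_n) i : cabs (x i 0) <= vnorm p x.
Proof.
move: hp; case: p => [[//|q] _|_]; last exact: (le_bigmax _ (fun i => cabs (x i 0))).
rewrite -(@ler_pXn2r _ q.+1) ?nnegrE ?cabs_ge0 ?powR_ge0 //.
rewrite -sum_cabsX // (bigD1 i) //= lerDl.
by apply: sumr_ge0 => j _; rewrite exprn_ge0 ?cabs_ge0.
Qed.

Lemma vnorm0 n : vnorm p (0 : 'cV[C]_n) = 0.
Proof. by rewrite -(scale0r (0 : 'cV[C]_n)) vnormZ cabs0 mul0r. Qed.

Lemma vnorm_gt0 n (x : 'cV[C]_n) : (0 < vnorm p x) = (x != 0).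
Proof.
rewrite lt_def vnorm_ge0 andbT; congr negb; apply/eqP/eqP => [x0|->].
  apply/colP => i; apply/eqP; rewrite mxE -cabs_eq0 eq_le cabs_ge0 andbT.
  by rewrite -x0 cabs_le_vnorm.
exact: vnorm0.
Qed.

Lemma convex_exprn (a b u v : R) k : 0 <= a -> 0 <= b -> a + b = 1 ->
  0 <= u -> 0 <= v -> (a * u + b * v) ^+ k.+1 <= a * u ^+ k.+1 + b * v ^+ k.+1.
Proof.
move=> a0 b0 ab u0 v0; have a1 : a <= 1 by rewrite -ab lerDl.
have k1 : (1 : R) <= k.+1%:R by rewrite ler1n.
have bE : b = 1 - a by rewrite -ab; ring.
have uv0 : 0 <= a * u + b * v by rewrite addr_ge0 // mulr_ge0.
rewrite -!powR_mulrn // bE.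
have := @convex_powR R _ k1 (Itv01 a0 a1) u v.
by rewrite !inE /= !in_itv /= u0 v0 => /(_ isT isT).
Qed.

Lemma vnormD n (x y : 'cV[C]_n) : vnorm p (x + y) <= vnorm p x + vnorm p y.
Proof.
have [->|x0] := eqVneq x 0; first by rewrite add0r vnorm0 add0r.
have [->|y0] := eqVneq y 0; first by rewrite addr0 vnorm0 addr0.
rewrite -!vnorm_gt0 in x0 y0; move: x0 y0 hp.
case: p => [[//|q]|] x0 y0 _; last first.
  apply: bigmax_le => [|i _]; first by rewrite addr_ge0 // ltW.
  rewrite mxE (le_trans (cabsD _ _)) // lerD //.
    exact: (le_bigmax _ (fun i => cabs (x i 0))).
  exact: (le_bigmax _ (fun i => cabs (y i 0))).
set a := vnorm _ x in x0 *; set b := vnorm _ y in y0 *.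
have ab0 : 0 < a + b by rewrite addr_gt0.
have aneq0 : a != 0 by rewrite gt_eqF.
have bneq0 : b != 0 by rewrite gt_eqF.
have abneq0 : a + b != 0 by rewrite gt_eqF.
apply: vnorm_le => //; first exact: ltW.
(* Minkowski: normalise both vectors and use the convexity of the power *)
pose f i := (a + b) ^+ q.+1 *
  (a / (a + b) * (cabs (x i 0) / a) ^+ q.+1 + b / (a + b) * (cabs (y i 0) / b) ^+ q.+1).
apply: (@le_trans _ _ (\sum_i f i)).
  apply: ler_sum => i _; rewrite mxE.
  apply: (@le_trans _ _ ((cabs (x i 0) + cabs (y i 0)) ^+ q.+1)).
    by rewrite lerXn2r ?nnegrE ?addr_ge0 ?cabs_ge0 ?cabsD.
  rewrite [leLHS](_ : _ = (a + b) ^+ q.+1 * (a / (a + b) * (cabs (x i 0) / a) +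
      b / (a + b) * (cabs (y i 0) / b)) ^+ q.+1); last first.
    by rewrite -exprMn; congr (_ ^+ _); field; rewrite aneq0 bneq0 abneq0.
  rewrite ler_pM2l ?exprn_gt0 // convex_exprn ?divr_ge0 ?cabs_ge0 // ?ltW //.
  by rewrite -mulrDl divff.
rewrite -mulr_sumr big_split /= -!mulr_sumr.
apply: ler_piMr; first by rewrite exprn_ge0 // ltW.
rewrite [leLHS](_ : _ = 1) //.
have E (z : 'cV[C]_n) : vnorm (Some q.+1) z != 0 ->
    \sum_(i < n) (cabs (z i 0) / vnorm (Some q.+1) z) ^+ q.+1 = 1.
  move=> z0; rewrite (eq_bigr _ (fun i _ => exprMn _ _ _)).
  by rewrite -mulr_suml sum_cabsX // -exprMn divff // expr1n.
by rewrite !E // !mulr1 -mulrDl divff.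
Qed.

Lemma vnorm_sum n (I : Type) (r : seq I) (P : pred I) (f : I -> 'cV[C]_n) :
  vnorm p (\sum_(i <- r | P i) f i) <= \sum_(i <- r | P i) vnorm p (f i).
Proof.
elim/big_ind2: _ => [|a b c d ab cd|//]; first by rewrite vnorm0.
exact: le_trans (vnormD _ _) (lerD ab cd).
Qed.

Lemma vnorm_mul_le n (A : 'M[C]_n) : exists2 c, 0 <= c &
  forall x : 'cV[C]_n, vnorm p (A *m x) <= c * vnorm p x.
Proof.
exists (\sum_j vnorm p (col j A)); first by apply: sumr_ge0 => j _; exact: vnorm_ge0.
move=> x; have -> : A *m x = \sum_j x j 0 *: col j A.
  apply/colP => i; rewrite !mxE summxE; apply: eq_bigr => j _.
  by rewrite !mxE mulrC.
apply: le_trans (vnorm_sum _ _ _) _; rewrite mulr_suml; apply: ler_sum => j _.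
by rewrite vnormZ mulrC ler_wpM2l ?vnorm_ge0 ?cabs_le_vnorm.
Qed.

Lemma vnorm_opnorm n (A : 'M[C]_n) x : vnorm p (A *m x) <= opnorm p A * vnorm p x.
Proof.
have [->|x0] := eqVneq x 0; first by rewrite mulmx0 vnorm0 mulr0.
have vx : 0 < vnorm p x by rewrite vnorm_gt0.
rewrite -ler_pdivrMr //; apply: ub_le_sup; last by exists x.
have [c _ cA] := vnorm_mul_le A; exists c => _ [y /= y0 <-].
by rewrite ler_pdivrMr ?vnorm_gt0.
Qed.

Lemma opnorm_le n (A : 'M[C]_n.+1) c :
  (forall x, vnorm p (A *m x) <= c * vnorm p x) -> opnorm p A <= c.
Proof.
move=> Ac; apply: ge_sup => [|_ [x /= x0 <-]]; last by rewrite ler_pdivrMr ?vnorm_gt0.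
pose e := const_mx 1 : 'cV[C]_n.+1.
exists (vnorm p (A *m e) / vnorm p e), e => //=.
by apply/eqP => /matrixP/(_ 0 0)/eqP; rewrite !mxE oner_eq0.
Qed.

(** The modulus passes through the product, and the norm of a vector depends
    only on the moduli of its entries. *)
Lemma vnorm_dominated n (Q : 'M[C]_n) (A : 'M[R]_n) x :
  (forall i j, cabs (Q i j) <= A i j) ->
  vnorm p (Q *m x) <= opnormR p A * vnorm p x.
Proof.
move=> QA; pose y := (\col_i (cabs (x i 0))%:C%C) : 'cV[C]_n.
have -> : vnorm p x = vnorm p y.
  by apply: vnorm_cabs => i; rewrite mxE cabs_real ger0_norm ?cabs_ge0.
apply: le_trans (vnorm_opnorm _ _); apply: le_vnorm => i.
rewrite !mxE [X in _ <= cabs X](eq_bigr (fun j => (A i j * cabs (x j 0))%:C%C)); last first.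
  by move=> j _; rewrite !mxE rmorphM.
rewrite -rmorph_sum cabs_real /= ger0_norm; last first.
  by apply: sumr_ge0 => j _; rewrite mulr_ge0 ?cabs_ge0 ?(le_trans _ (QA _ _)) ?cabs_ge0.
apply: le_trans (cabs_sum _ _ _) _; apply: ler_sum => j _.
by rewrite cabsM ler_wpM2r ?cabs_ge0.
Qed.

Lemma opnormR_gt0 n (A : 'M[R]_n) : A <> 0 -> 0 < opnormR p A.
Proof.
move=> A0; have [j Aj] : exists j, col j A != 0.
  apply: contrapT => /forallNP H; apply: A0; apply/matrixP => i j.
  by have /negP/negPn/eqP/colP/(_ i) := H j; rewrite !mxE.
pose e := (delta_mx j 0 : 'cV[C]_n).
have := vnorm_opnorm (map_mx (real_complex R) A) e.
have e0 : 0 < vnorm p e.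
  rewrite vnorm_gt0; apply/eqP => /colP/(_ j)/eqP.
  by rewrite !mxE !eqxx oner_eq0.
rewrite -ler_pdivrMr //; apply: lt_le_trans; rewrite divr_gt0 // vnorm_gt0.
apply/eqP => E; move/eqP: Aj; apply; apply/colP => i.
move/colP: E => /(_ i); rewrite -colE !mxE => -[] //.
Qed.

End VectorNorm.

(** * The remainder of the complex exponential *)

Section ComplexExponential.
Variable R : realType.
Local Notation C := (complex R).
Implicit Types (c z w : C) (s : R).

Lemma cReD z w : complex.Re (z + w) = complex.Re z + complex.Re w.
Proof. by case: z w => [a b] [d e]. Qed.
Lemma cReB z w : complex.Re (z - w) = complex.Re z - complex.Re w.
Proof. by case: z w => [a b] [d e]. Qed.
Lemma cImB z w : complex.Im (z - w) = complex.Im z - complex.Im w.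
Proof. by case: z w => [a b] [d e]. Qed.
Lemma cImD z w : complex.Im (z + w) = complex.Im z + complex.Im w.
Proof. by case: z w => [a b] [d e]. Qed.
Lemma cReM z w : complex.Re (z * w) =
  complex.Re z * complex.Re w - complex.Im z * complex.Im w.
Proof. by case: z w => [a b] [d e]. Qed.
Lemma cImM z w : complex.Im (z * w) =
  complex.Re z * complex.Im w + complex.Im z * complex.Re w.
Proof. by case: z w => [a b] [d e]. Qed.

Lemma cRe_sum (I : Type) (r : seq I) (P : pred I) (f : I -> C) :
  complex.Re (\sum_(i <- r | P i) f i) = \sum_(i <- r | P i) complex.Re (f i).
Proof. by elim/big_rec2: _ => [|i a b _ <-] //; rewrite cReD. Qed.

Lemma cexpD z w : cexp (z + w) = cexp z * cexp w.
Proof.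
apply/eqP; rewrite eq_complex cReM cImM /= cReD cImD expRD cosD sinD.
by apply/andP; split; apply/eqP; ring.
Qed.

Lemma cabs_cexp z : cabs (cexp z) = expR (complex.Re z).
Proof.
by rewrite /cabs /= !exprMn -mulrDr cos2Dsin2 mulr1 sqrtr_sqr ger0_norm ?expR_ge0.
Qed.

(** Testing against all [c] recovers the modulus: take [c] to be the conjugate. *)
Lemma cabs_le_Re z b :
  (forall c, complex.Re (c * z) <= cabs c * b) -> cabs z <= b.
Proof.
have [->|z0] := eqVneq z 0 => H.
  by rewrite cabs0; move: (H 1); rewrite mulr0 cabs1 mul1r.
have := H (conjc z).
have -> : complex.Re (conjc z * z) = cabs z * cabs z.
  case: z {H z0} => a b'; rewrite -[RHS]expr2 /cabs /= sqr_sqrtr ?addr_ge0 ?sqr_ge0 //; ring.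
have -> : cabs (conjc z) = cabs z.
  by case: z {H z0} => a b'; rewrite /cabs /= sqrrN.
by rewrite ler_pM2l ?cabs_gt0.
Qed.

(** A bound on the derivative integrates to a bound on the function. *)
Lemma ler_norm_derive (f g f' g' : R -> R) s : 0 <= s ->
  (forall x : R, is_derive x (1 : R) f (f' x)) ->
  (forall x : R, is_derive x (1 : R) g (g' x)) ->
  (forall x, 0 <= x -> `|f' x| <= g' x) -> `|f 0| <= g 0 -> `|f s| <= g s.
Proof.
move=> s0 df dg fg fg0.
have mono (h h' : R -> R) : (forall x : R, is_derive x (1 : R) h (h' x)) ->
    (forall x, 0 <= x -> 0 <= h' x) -> h 0 <= h s.
  move=> dh h0; apply: (@ger0_derive1_ndecr _ h 0 s) => //.
  - by move=> x; rewrite in_itv /= => /andP[x0 _]; rewrite derive1E derive_val h0 // ltW.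
  - apply: continuous_subspaceT => x; apply: differentiable_continuous.
    exact/derivable1_diffP.
have := mono _ _ (fun x => is_deriveB (dg x) (df x)).
have := mono _ _ (fun x => is_deriveD (dg x) (df x)).
move: fg0; rewrite !ler_norml !fctE /= => /andP[f0 f0'] H1 H2.
have {}H1 := H1 _; have {}H2 := H2 _.
have /H1 h1 : forall x, 0 <= x -> 0 <= g' x + f' x.
  by move=> x /fg; rewrite ler_norml => /andP[]; lra.
have /H2 h2 : forall x, 0 <= x -> 0 <= g' x - f' x.
  by move=> x /fg; rewrite ler_norml => /andP[]; lra.
by apply/andP; split; lra.
Qed.

(* The remainder is tested against a constant [c] and restricted to the ray
   [s |-> s * w]: differentiating in [s] then amounts to replacing [c] by
   [c * w] and lowering the order of the Taylor polynomial by one. *)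
Let phi c w s := complex.Re (c * cexp (w * s%:C%C)).
Let T c w M s := \sum_(m < M) complex.Re (c * w ^+ m) * (s ^+ m / m`!%:R).

Lemma is_derive_phi c w s : is_derive (s : R) (1 : R) (phi c w) (phi (c * w) w s).
Proof.
case: c w => [a b] [x y]; rewrite /phi.
have -> : (fun s => complex.Re ((a +i* b)%C * cexp ((x +i* y)%C * s%:C%C))) =
   (fun s => a * (expR (x * s) * cos (y * s)) - b * (expR (x * s) * sin (y * s))).
  by apply/funext => t /=; rewrite !mulr0 subr0 add0r.
apply: is_derive_eq.
by rewrite /GRing.scale /= !mulr1 !mulr0 subr0 add0r; ring.
Qed.

Lemma is_derive_T c w M s : is_derive (s : R) (1 : R) (T c w M.+1) (T (c * w) w M s).
Proof.
elim: M => [|M IH].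
  have -> : T c w 1 = cst (complex.Re c).
    by apply/funext => t; rewrite /T big_ord1 expr0 expr0 divr1 !mulr1.
  by rewrite /T big_ord0; exact: is_derive_cst.
have -> : T c w M.+2 =
    T c w M.+1 + (fun t => complex.Re (c * w ^+ M.+1) * (t ^+ M.+1 / M.+1`!%:R)).
  by apply/funext => t; rewrite /T big_ord_recr.
set k := complex.Re _; have -> : (fun t => k * (t ^+ M.+1 / M.+1`!%:R)) =
    (fun t => (k / M.+1`!%:R) * t ^+ M.+1) by apply/funext => t; ring.
rewrite [X in is_derive _ _ _ X](_ : _ = T (c * w) w M s +
    k * (s ^+ M / M`!%:R)); last first.
  by rewrite /T big_ord_recr /= -mulrA -exprS.
suff D : is_derive (s : R) (1 : R) (fun t : R => (k / M.+1`!%:R) * t ^+ M.+1)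
    (k * (s ^+ M / M`!%:R)) by exact: (is_deriveD IH D).
have := is_deriveZ (k / M.+1`!%:R) (is_deriveX M.+1 (is_derive_id s (1 : R))).
rewrite [X in is_derive _ _ X _ -> _](_ : _ = fun t : R => (k / M.+1`!%:R) * t ^+ M.+1); last first.
  by rewrite exprfctE.
move=> D; apply: is_derive_eq.
have M0 : M`!%:R != 0 :> R by rewrite pnatr_eq0 -lt0n fact_gt0.
have M1 : 1 + M%:R != 0 :> R by rewrite addrC natr1 pnatr_eq0.
rewrite /GRing.scale /= factS natrM; field.
by rewrite M0 M1.
Qed.

Lemma Re_cexp_remainder (r : R) M c w s : 0 < r <= 1 -> 0 <= s ->
  `|phi c w s - T c w M s| <= cabs c * (r ^+ M * expR (cabs w / r * s)).
Proof.
move=> /andP[r0 r1]; elim: M c s => [|M IH] c s s0.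
  rewrite /T big_ord0 subr0 expr0 mul1r (le_trans (normr_Re_cabs _)) //.
  rewrite cabsM ler_wpM2l ?cabs_ge0 // cabs_cexp ler_expR cReM /= mulr0 subr0.
  rewrite ler_wpM2r // (le_trans (ler_norm _)) // (le_trans (normr_Re_cabs _)) //.
  by rewrite ler_peMr ?cabs_ge0 // invf_ge1.
pose g' x := cabs (c * w) * (r ^+ M * expR (cabs w / r * x)).
pose f x := phi c w x - T c w M.+1 x.
pose g x := cabs c * (r ^+ M.+1 * expR (cabs w / r * x)).
apply: (@ler_norm_derive f g (fun x => phi (c * w) w x - T (c * w) w M x) g') => //.
- by move=> x; apply: is_deriveB; [exact: is_derive_phi|exact: is_derive_T].
- move=> x; apply: is_derive_eq.
  by rewrite /g' cabsM /GRing.scale /= exprS; field; rewrite gt_eqF.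
- by move=> x x0; exact: IH.
- rewrite /f /g [_ - _](_ : _ = 0) ?normr0 ?mulr_ge0 ?cabs_ge0 ?exprn_ge0 ?expR_ge0 ?ltW //.
  rewrite /phi /T big_ord_recl big1 => [|m _]; last by rewrite expr0n /= mul0r mulr0.
  rewrite /= !expr0 divr1 !mulr1 addr0.
  have -> : cexp (w * 0%:C%C) = 1.
    by rewrite mulr0 /cexp /= expR0 cos0 sin0 mulr1 mulr0.
  by rewrite mulr1 subrr.
Qed.

(** For [r = 1] this is the crude bound; a smaller [r] trades a geometric gain
    for a dilation of the exponent. *)
Lemma cexp_remainder (r : R) M w : 0 < r <= 1 ->
  cabs (cexp w - \sum_(m < M) w ^+ m / m`!%:R) <= r ^+ M * expR (cabs w / r).
Proof.
move=> r01; apply: cabs_le_Re => c.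
have := @Re_cexp_remainder r M c w 1 r01 ler01.
rewrite !mulr1 => /(le_trans (ler_norm _)); congr (_ <= _).
rewrite /phi /T mulr1 mulrBr mulr_sumr cReB cRe_sum.
congr (_ - _); apply: eq_bigr => m _.
rewrite expr1n mul1r [in RHS]mulrA -[in RHS](rmorph_nat (real_complex R)) -fmorphV.
by rewrite [in RHS]cReM /= mulr0 subr0.
Qed.
End ComplexExponential.

(** * The weight of Euler's integral and its integrability *)

Section Weight.
Variable R : realType.
Local Open Scope classical_set_scope.
Implicit Types (s t : R) (f F : R -> R).
Local Notation mu := (@lebesgue_measure R).

Lemma derivable_continuous f x : derivable f x (1 : R) -> {for x, continuous f}.
Proof. by move=> df; apply: differentiable_continuous; exact/derivable1_diffP. Qed.

Lemma measurable_pos_reals : measurable (`]0, +oo[ : set R).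
Proof. exact: measurable_itv. Qed.

Lemma measurable_fun_pos_reals f : (forall x : R, 0 < x -> derivable f x (1 : R)) ->
  measurable_fun (`]0, +oo[ : set R) f.
Proof.
move=> df; apply: open_continuous_measurable_fun; first exact: interval_open.
by move=> x; rewrite inE /= in_itv /= andbT => x0; apply: derivable_continuous; exact: df.
Qed.

(** A nonnegative function with a bounded primitive is integrable; the domain
    is exhausted by compact intervals, which covers both an open left end and
    an unbounded right end. *)
Lemma ge0_integral_primitive (D : set R) (a b : nat -> R) f F B :
  measurable D -> D `<=` `]0, +oo[ ->
  (forall n, 0 < a n < b n) -> (forall n, a n.+1 <= a n) -> (forall n, b n <= b n.+1) ->
  D = \bigcup_n `[a n, b n] ->
  (forall x, D x -> 0 <= f x) -> (forall n, 0 <= F (a n)) -> (forall n, F (b n) <= B) ->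
  (forall x : R, 0 < x -> derivable f x (1 : R)) ->
  (forall x : R, 0 < x -> is_derive x (1 : R) F (f x)) ->
  mu.-integrable D (EFin \o f) /\ \int[mu]_(x in D) f x <= B.
Proof.
move=> mD D0 ab aS bS DE f0 Fa FB df dF.
have mf : measurable_fun D (EFin \o f).
  apply/measurable_EFinP; apply: measurable_funS (measurable_fun_pos_reals df) => //.
have abD n : `[a n, b n] `<=` D by rewrite DE => x xn; exists n.
have int_n n : (\int[mu]_(x in `[a n, b n]) (f x)%:E = (F (b n) - F (a n))%:E)%E.
  have /andP[a0 anb] := ab n.
  have cF x : 0 < x -> {for x, continuous F}.
    by move=> x0; apply: derivable_continuous; have [] := dF x x0.
  rewrite (@continuous_FTC2 _ f F) //.
  - apply: continuous_in_subspaceT => x; rewrite inE /= in_itv /= => /andP[ax _].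
    by apply: derivable_continuous; apply: df; exact: lt_le_trans ax.
  - split.
    + by move=> x; rewrite in_itv /= => /andP[ax _]; have [] := dF x (lt_trans a0 ax).
    + by apply: cvg_at_right_filter; exact: cF.
    + by apply: cvg_at_left_filter; apply: cF; exact: lt_trans anb.
  - move=> x; rewrite in_itv /= => /andP[ax _].
    by have d := dF x (lt_trans a0 ax); rewrite derive1E derive_val.
have intD : (\int[mu]_(x in D) (f x)%:E <= B%:E)%E.
  have H : (\int[mu]_(x in `[a n, b n]) (f x)%:E)%E @[n --> \oo] -->
      (\int[mu]_(x in \bigcup_n `[a n, b n]) (f x)%:E)%E.
    apply: ge0_nondecreasing_set_cvg_integral.
    - apply: homo_leq; [by move=> x; exact: lexx|by move=> x y z; exact: le_trans|move=> n].
      rewrite subsetEset => x; rewrite /= !in_itv /= => /andP[h1 h2].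
      by rewrite (le_trans (aS n)) // (le_trans h2).
    - by move=> n; exact: measurable_itv.
    - by move=> n; apply: measurable_funS mf.
    - by move=> n x xn; rewrite lee_fin f0 //; exact: (abD n).
  rewrite DE; apply: (cvge_le _ H); apply: nearW => n; rewrite int_n lee_fin.
  by have := Fa n; have := FB n; lra.
have abs_f : (\int[mu]_(x in D) `|(f x)%:E| = \int[mu]_(x in D) (f x)%:E)%E.
  by apply: eq_integral => x; rewrite inE => Dx; rewrite gee0_abs // lee_fin f0.
split; first by apply/integrableP; split => //; rewrite abs_f (le_lt_trans intD) // ltry.
rewrite /Rintegral -lee_fin fineK // ge0_fin_numE ?(le_lt_trans intD) ?ltry //.
by apply: integral_ge0 => x Dx; rewrite lee_fin f0.
Qed.

Lemma integrable_dominated (f g : R -> R) : measurable_fun (`]0, +oo[ : set R) f ->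
  (forall x, (`]0, +oo[ : set R) x -> `|f x| <= g x) ->
  mu.-integrable `]0, +oo[ (EFin \o g) -> mu.-integrable `]0, +oo[ (EFin \o f).
Proof.
move=> mf fg; apply: le_integrable => //; first exact/measurable_EFinP.
by move=> x Dx; rewrite /= lee_fin (le_trans (fg x Dx)) // ler_norm.
Qed.

Lemma pos_reals_bigcup : `]0, +oo[ = \bigcup_n `[(n.+2%:R)^-1, n.+2%:R : R].
Proof.
apply/seteqP; split => x; rewrite /= in_itv /= ?andbT; last first.
  by case=> n _; rewrite /= in_itv /= => /andP[+ _]; apply: lt_le_trans; rewrite invr_gt0.
move=> x0; pose n := maxn (Num.truncn x) (Num.truncn x^-1).
exists n => //; rewrite /= in_itv /=; apply/andP; split.
  rewrite invf_ple ?posrE // (le_trans (ltW (truncnS_gt _))) // ler_nat.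
  by rewrite ltnS ltnW // ltnS leq_maxr.
rewrite (le_trans (ltW (truncnS_gt _))) // ler_nat.
by rewrite ltnS ltnW // ltnS leq_maxl.
Qed.

Lemma unit_interval_bigcup : `]0, 1] = \bigcup_n `[(n.+2%:R)^-1, 1 : R].
Proof.
apply/seteqP; split => x; rewrite /= in_itv /=; last first.
  case=> n _; rewrite /= in_itv /= => /andP[+ ->]; rewrite andbT.
  by apply: lt_le_trans; rewrite invr_gt0.
move=> /andP[x0 x1]; exists (Num.truncn x^-1) => //; rewrite /= in_itv /= x1 andbT.
rewrite invf_ple ?posrE // (le_trans (ltW (truncnS_gt _))) // ler_nat; exact: leqnSn.
Qed.


Lemma expR_lnB1 s t : 0 < t -> expR ((s - 1) * ln t) = expR (s * ln t) / t.
Proof. by move=> t0; rewrite mulrBl mul1r expRB lnK. Qed.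

Lemma is_derive_expRln s t : 0 < t ->
  is_derive t (1 : R) (fun t => expR (s * ln t)) (s * expR ((s - 1) * ln t)).
Proof.
move=> t0; have dln := is_derive1_ln t0.
apply: is_derive_eq.
by rewrite expR_lnB1 // /GRing.scale /=; field; rewrite gt_eqF.
Qed.

(** The weight [expR (- t) * t ^ (s - 1)], with the power written through the
    logarithm. *)
Definition gwt s t := expR (- t) * expR ((s - 1) * ln t).

Lemma gwt_ge0 s t : 0 <= gwt s t. Proof. by rewrite mulr_ge0 ?expR_ge0. Qed.

Lemma gwtD s h t : gwt (s + h) t = gwt s t * expR (h * ln t).
Proof. rewrite /gwt -[in RHS]mulrA -[in RHS]expRD; by congr (_ * expR _); ring. Qed.

Lemma ln_le_linear s t : 0 < s -> 0 < t -> s * ln t <= s * ln s + t.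
Proof.
move=> s0 t0; have := expR_ge1Dx (ln t - ln s).
rewrite expRB !lnK // ler_pdivlMr // => h.
suff : s * (ln t - ln s) <= t by lra.
by apply: le_trans h; rewrite mulrC ler_wpM2r ?ltW //; lra.
Qed.

Lemma gwt_integrable s : 0 < s -> mu.-integrable `]0, +oo[ (EFin \o gwt s).
Proof.
move=> s0.
(* [g] is the derivative of the bounded function [t ^ s / (1 + t ^ s)], and it
   dominates the weight because [(1 + t ^ s) ^ 2 * expR (- t)] is bounded. *)
pose v t := (1 + expR (s * ln t))^-1.
pose g t := s * expR ((s - 1) * ln t) * (v t * v t).
pose F t := 1 - v t.
have pos (x : R) : 0 < 1 + expR (s * ln x) by rewrite addr_gt0 ?expR_gt0.
have neq0 (x : R) : 1 + expR (s * ln x) != 0 by rewrite gt_eqF.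
have dexp s' (x : R) : 0 < x -> derivable (fun t => expR (s' * ln t)) x (1 : R).
  by move=> x0; have [] := is_derive_expRln s' x0.
have dv (x : R) : 0 < x -> is_derive x (1 : R) v (- g x).
  move=> x0; have d := is_derive_expRln s x0.
  pose w t := 1 + expR (s * ln t).
  have dw : is_derive x (1 : R) w (0 + s * expR ((s - 1) * ln x)).
    exact: is_deriveD (is_derive_cst _ _ _) d.
  have dV : is_derive x (1 : R) v _ := is_deriveV (f := w) (neq0 x) dw.
  apply: is_derive_eq; rewrite /g /v /w /GRing.scale /=; move: (neq0 x) => n0. field.
  exact: n0.
have v0 (x : R) : 0 <= v x <= 1.
  rewrite invr_ge0 ltW ?pos //= invf_le1 ?pos // lerDl; exact: expR_ge0.
have g0 (x : R) : 0 <= g x.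
  have /andP[h _] := v0 x.
  by apply: mulr_ge0; apply: mulr_ge0; rewrite ?expR_ge0 // ltW.
have inv_lt1 n : (n.+2%:R : R)^-1 < 1 by rewrite invf_lt1 ?ltr0n // ltr1n.
have dg (x : R) : 0 < x -> derivable g x (1 : R).
  move=> x0; have [dvx _] := dv x x0.
  apply: derivableM; last exact: (derivableM dvx dvx).
  exact: (derivableM (derivable_cst _ _ _) (dexp _ _ x0)).
have [gi _] : mu.-integrable `]0, +oo[ (EFin \o g) /\ \int[mu]_(t in `]0, +oo[) g t <= 1.
  apply: (ge0_integral_primitive (F := F) measurable_pos_reals _ _ _ _ pos_reals_bigcup).
  - exact: subset_refl.
  - by move=> n; rewrite invr_gt0 ltr0n /= (lt_trans (inv_lt1 n)) // ltr1n.
  - by move=> n; rewrite lef_pV2 ?posrE ?ltr0n // ler_nat.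
  - by move=> n; rewrite ler_nat.
  - by move=> x _; exact: g0.
  - by move=> n; rewrite subr_ge0; have /andP[] := v0 (n.+2%:R^-1).
  - by move=> n; rewrite gerBl; have /andP[] := v0 (n.+2%:R).
  - exact: dg.
  - move=> x x0; rewrite (_ : g x = 0 - - g x); last by rewrite sub0r opprK.
    exact: is_deriveB (is_derive_cst _ _ _) (dv x x0).
pose C := 2 * (1 + expR (2 * s * ln (2 * s))) / s.
have Cgi : mu.-integrable `]0, +oo[ (EFin \o (fun t => C * g t)).
  rewrite (_ : _ \o _ = (fun t => C%:E * (EFin \o g) t)%E) //; exact: integrableZl.
apply: integrable_dominated Cgi => [|x].
  apply: measurable_fun_pos_reals => x x0.
  have dN : is_derive x (1 : R) (fun t => expR (- t)) (expR (- x) * -1).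
    by apply: is_derive_eq; rewrite mulrC.
  have [dNx _] := dN; exact: (derivableM dNx (dexp _ _ x0)).
rewrite /= in_itv /= andbT => x0; rewrite ger0_norm ?gwt_ge0 //.
have u0 := expR_ge0 (s * ln x); have := pos x; rewrite /gwt /g /v.
set u := expR (s * ln x) in u0 * => u1.
set E := expR ((s - 1) * _).
have -> : C * (s * E * ((1 + u)^-1 / (1 + u))) = E * (C * s / (1 + u) ^+ 2).
  by field; rewrite gt_eqF.
rewrite [leLHS]mulrC.
rewrite ler_wpM2l ?expR_ge0 // ler_pdivlMr ?exprn_gt0 //.
rewrite /C divfK ?gt_eqF //.
have e1 : expR (- x) <= 1 by rewrite -expR0 ler_expR oppr_le0 ltW.
have e2 : expR (- x) * u ^+ 2 <= expR (2 * s * ln (2 * s)).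
  rewrite /u -expRM_natl -expRD ler_expR.
  by have := @ln_le_linear (2 * s) x; rewrite pmulr_rgt0 // => /(_ s0 x0); lra.
apply: (@le_trans _ _ (expR (- x) * (2 * (1 + u ^+ 2)))).
  by rewrite ler_wpM2l ?expR_ge0 //; have := sqr_ge0 (1 - u); rewrite sqrrB sqrrD; lra.
lra.
Qed.

End Weight.

(** * The logarithmic moment on the unit interval *)

Section LogMoment.
Variable R : realType.
Local Open Scope classical_set_scope.
Implicit Types (s t x y : R).
Local Notation mu := (@lebesgue_measure R).

(* The logarithmic weight [- t ^ (y - 1) * ln t] and its primitive vanishing at
   the origin. *)
Let lw y t := expR ((y - 1) * ln t) * - ln t.
Let lP y t := expR (y * ln t) * (y ^- 2 - ln t / y).

Let lwD1 y t : 0 < t -> lw (y + 1) t = t * lw y t.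
Proof.
by move=> t0; rewrite /lw !expR_lnB1 // mulrDl mul1r expRD lnK //; ring.
Qed.

Let is_derive_lw y t : 0 < t -> derivable (lw y) t (1 : R).
Proof.
move=> t0; have dln := is_derive1_ln t0; have de := is_derive_expRln (y - 1) t0.
have [] // : is_derive t (1 : R) (lw y) _ := is_deriveM de (is_deriveN dln).
Qed.

Let is_derive_lP y t : 0 < y -> 0 < t -> is_derive t (1 : R) (lP y) (lw y t).
Proof.
move=> y0 t0; have dln := is_derive1_ln t0; have de := is_derive_expRln y t0.
have dl : is_derive t (1 : R) (fun t => y ^- 2 - ln t / y) (0 - y^-1 *: t^-1).
  rewrite (_ : (fun t => _) = cst (y ^- 2) - (y^-1 *: (@ln R))).
    exact: is_deriveB (is_derive_cst _ _ _) (is_deriveZ _ dln).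
  by apply/funext => u; rewrite !fctE [_ *: _]mulrC.
have d : is_derive t (1 : R) (lP y) _ := is_deriveM de dl.
apply: is_derive_eq; rewrite /lw !expR_lnB1 // /GRing.scale /=.
by field; rewrite !gt_eqF.
Qed.

Let lP_ge y t : 0 < y -> 0 < t <= 1 -> 0 <= lP (y + 1) t <= lP y t.
Proof.
move=> y0 /andP[t0 t1]; have l0 : 0 <= - ln t by rewrite oppr_ge0 ln_le0.
have y1 : 0 < y + 1 by rewrite addr_gt0.
have bE z : z ^- 2 - ln t / z = z ^- 2 + - ln t * z^-1 by rewrite mulNr.
have b0 : 0 <= (y + 1) ^- 2 - ln t / (y + 1).
  by rewrite bE addr_ge0 ?mulr_ge0 ?invr_ge0 ?exprn_ge0 // ltW.
apply/andP; split; first by rewrite mulr_ge0 ?expR_ge0.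
have inv : (y + 1)^-1 <= y^-1 by rewrite lef_pV2 ?posrE // lerDl.
apply: ler_pM; [exact: expR_ge0|exact: b0|by rewrite ler_expR; nra|].
rewrite !bE lerD ?ler_wpM2l // -!exprVn lerXn2r ?nnegrE ?invr_ge0 // ltW //.
Qed.

Lemma expR_ge_quadratic t : 0 <= t -> 1 + t + t ^+ 2 / 2 <= expR t.
Proof.
move=> t0.
have := @ler_norm_derive R (fun t => 1 + t + t ^+ 2 / 2) expR (fun t => 1 + t) expR t t0.
move=> /(_ _ _ _ _)/(le_trans (ler_norm _)); apply.
- move=> x; rewrite (_ : (fun t => _) = (fun t => 1 + t + 2^-1 * (t * t))); last first.
    by apply/funext => u; field.
  by apply: is_derive_eq; rewrite /GRing.scale /=; field.
- by move=> x x0; rewrite ger0_norm ?addr_ge0 // expR_ge1Dx.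
- by rewrite expR0 expr0n /= mul0r !addr0 normr1.
Qed.

Lemma expRN_le t : 0 <= t -> expR (- t) <= 1 - t + t ^+ 2 / 2.
Proof.
move=> t0; have h := expR_ge_quadratic t0.
have e0 := expR_gt0 t.
rewrite expRN -[leLHS]mul1r ler_pdivrMr //.
apply: (@le_trans _ _ ((1 - t + t ^+ 2 / 2) * (1 + t + t ^+ 2 / 2))).
  have := sqr_ge0 (t ^+ 2); rewrite !expr2; nra.
by rewrite ler_wpM2l //; nra.
Qed.

(** The function [- expR (- t) * t ^ (x - 1) * ln t] with the exponential replaced
    by its quadratic Taylor polynomial. *)
Definition log_majorant x t :=
  (1 - t + t ^+ 2 / 2) * (expR ((x - 1) * ln t) * - ln t).

Let log_majorantE x t : 0 < t ->
  log_majorant x t = lw x t - lw (x + 1) t + 2^-1 * lw (x + 2) t.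
Proof.
move=> t0; rewrite (_ : x + 2 = x + 1 + 1); last by ring.
by rewrite !lwD1 // /log_majorant -/(lw x t); field.
Qed.

Lemma gwt_le_log_majorant x t : 0 < t <= 1 ->
  gwt x t * - ln t <= log_majorant x t.
Proof.
move=> /andP[t0 t1]; rewrite /gwt /log_majorant -mulrA; apply: ler_wpM2r; last exact/expRN_le/ltW.
by apply: mulr_ge0; [exact: expR_ge0|rewrite oppr_ge0 ln_le0].
Qed.

Lemma log_majorant_ge0 x t : 0 < t <= 1 -> 0 <= log_majorant x t.
Proof.
move=> t01; apply: le_trans (gwt_le_log_majorant x t01).
by case/andP: t01 => t0 t1; rewrite mulr_ge0 ?gwt_ge0 // oppr_ge0 ln_le0.
Qed.

(** The integral over the unit interval of [(1 - t + t ^ 2 / 2)] against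
    [- t ^ (x - 1) * ln t]. *)
Definition log_moment x := x ^- 2 - (x + 1) ^- 2 + 2^-1 * (x + 2) ^- 2.

Lemma integral_log_majorant x : 0 < x ->
  mu.-integrable `]0, 1] (EFin \o log_majorant x) /\
  \int[mu]_(t in `]0, 1]) log_majorant x t <= log_moment x.
Proof.
move=> x0; pose F t := lP x t - lP (x + 1) t + 2^-1 * lP (x + 2) t.
pose f t := lw x t - lw (x + 1) t + 2^-1 * lw (x + 2) t.
have x1 : 0 < x + 1 by rewrite addr_gt0.
have x2 : 0 < x + 2 by rewrite addr_gt0.
have fE t : (`]0, 1] : set R) t -> log_majorant x t = f t.
  by rewrite /= in_itv /= => /andP[t0 _]; exact: log_majorantE.
have fE' : {in (`]0, 1] : set R), log_majorant x =1 f}.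
  by move=> t; rewrite inE => /fE.
have df t : 0 < t -> derivable f t (1 : R).
  move=> t0; rewrite (_ : f = lw x - lw (x + 1) + (2^-1 \*: lw (x + 2))) //.
  have d1 := derivableB (@is_derive_lw x t t0) (@is_derive_lw (x + 1) t t0).
  apply: derivableD d1 _; exact: derivableZ (@is_derive_lw (x + 2) t t0).
have dF t : 0 < t -> is_derive t (1 : R) F (f t).
  move=> t0; rewrite (_ : F = lP x - lP (x + 1) + (2^-1 \*: lP (x + 2))) //.
  have d1 := is_deriveB (is_derive_lP x0 t0) (is_derive_lP x1 t0).
  exact: (is_deriveD d1 (is_deriveZ (2^-1) (is_derive_lP x2 t0))).
have [i le] : mu.-integrable `]0, 1] (EFin \o f) /\ \int[mu]_(t in `]0, 1]) f t <= log_moment x.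
  apply: (ge0_integral_primitive (F := F) _ _ _ _ _ (@unit_interval_bigcup R)).
  - exact: measurable_itv.
  - by move=> t; rewrite /= !in_itv /= andbT => /andP[].
  - by move=> n; rewrite invr_gt0 ltr0n /= invf_lt1 ?ltr0n // ltr1n.
  - by move=> n; rewrite lef_pV2 ?posrE ?ltr0n // ler_nat.
  - by [].
  - move=> t t01; rewrite -fE //; apply: log_majorant_ge0.
    by move: t01; rewrite /= in_itv.
  - move=> n; have t01 : 0 < (n.+2%:R : R)^-1 <= 1.
      by rewrite invr_gt0 ltr0n /= invf_le1 ?ltr0n // ler1n.
    have /andP[_ h1] := lP_ge x0 t01; have /andP[h2 _] := lP_ge x1 t01.
    rewrite /F (_ : x + 2 = x + 1 + 1); last by ring.
    by rewrite addr_ge0 ?subr_ge0 // mulr_ge0.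
  - by move=> n; rewrite /F /lP !ln1 !mulr0 expR0 !mul0r !subr0 !mul1r.
  - exact: df.
split; last by rewrite (eq_Rintegral mu fE').
by apply: eq_integrable i => // t t01; rewrite /= fE'.
Qed.

End LogMoment.

(** * Complex-valued integrals over the positive half-line *)

Section ComplexIntegral.
Variable R : realType.
Local Open Scope classical_set_scope.
Local Notation C := (complex R).
Local Notation mu := (@lebesgue_measure R).
Local Notation D := (`]0, +oo[ : set R).
Implicit Types (F G : R -> C) (f g : R -> R) (c : C).

(** The integral of a complex function, and its integrability, are taken on the
    real and imaginary parts. *)
Definition cint F : C :=
  ((\int[mu]_(t in D) complex.Re (F t)) +i* (\int[mu]_(t in D) complex.Im (F t)))%C.

Definition cintegrable F : Prop :=
  mu.-integrable D (fun t => (complex.Re (F t))%:E) /\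
  mu.-integrable D (fun t => (complex.Im (F t))%:E).

Let mD : measurable D := @measurable_pos_reals R.

Lemma cintD F G : cintegrable F -> cintegrable G ->
  cintegrable (fun t => F t + G t) /\ cint (fun t => F t + G t) = cint F + cint G.
Proof.
move=> [F1 F2] [G1 G2]; split.
  split.
    rewrite (_ : (fun t => _) = (fun t => (complex.Re (F t))%:E + (complex.Re (G t))%:E)%E).
      exact: integrableD.
    by apply/funext => t; rewrite cReD.
  rewrite (_ : (fun t => _) = (fun t => (complex.Im (F t))%:E + (complex.Im (G t))%:E)%E).
    exact: integrableD.
  by apply/funext => t; rewrite cImD.
apply/eqP; rewrite eq_complex cReD cImD /=; apply/andP; split; apply/eqP.
  by under eq_Rintegral do rewrite cReD; exact: RintegralD.
by under eq_Rintegral do rewrite cImD; exact: RintegralD.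
Qed.

Lemma cintZ F c : cintegrable F ->
  cintegrable (fun t => F t * c) /\ cint (fun t => F t * c) = cint F * c.
Proof.
move=> [F1 F2].
have Z (f : R -> R) (k : R) : mu.-integrable D (fun t => (f t)%:E) ->
    mu.-integrable D (fun t => (f t * k)%:E).
  move=> fi; rewrite (_ : (fun t => _) = (fun t => (f t)%:E * k%:E)%E) //.
  exact: integrableZr.
split.
  split.
    rewrite (_ : (fun t => _) = (fun t => (complex.Re (F t) * complex.Re c)%:E -
       (complex.Im (F t) * complex.Im c)%:E)%E).
      by apply: integrableB => //; exact: Z.
    by apply/funext => t; rewrite cReM.
  rewrite (_ : (fun t => _) = (fun t => (complex.Re (F t) * complex.Im c)%:E +
       (complex.Im (F t) * complex.Re c)%:E)%E).
    by apply: integrableD => //; exact: Z.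
  by apply/funext => t; rewrite cImM.
apply/eqP; rewrite eq_complex cReM cImM /=; apply/andP; split; apply/eqP.
  under eq_Rintegral do rewrite cReM.
  by rewrite RintegralB ?RintegralZr //; exact: Z.
under eq_Rintegral do rewrite cImM.
by rewrite RintegralD ?RintegralZr //; exact: Z.
Qed.

Lemma cint_sum M (F : nat -> R -> C) : (forall m, cintegrable (F m)) ->
  cintegrable (fun t => \sum_(m < M) F m t) /\
  cint (fun t => \sum_(m < M) F m t) = \sum_(m < M) cint (F m).
Proof.
move=> Fi; elim: M => [|M [IH1 IH2]].
  rewrite big_ord0 (_ : (fun t => _) = fun=> 0); last by apply/funext => t; rewrite big_ord0.
  split; first by split; exact: integrable0.
  by rewrite /cint /= Rintegral_cst // mul0r.
have := cintD IH1 (Fi M); rewrite big_ord_recr IH2 /=.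
rewrite (_ : (fun t => _ + _) = (fun t => \sum_(m < M.+1) F m t)) //.
by apply/funext => t; rewrite big_ord_recr.
Qed.

Lemma cabs_cint_le F g : cintegrable F -> mu.-integrable D (EFin \o g) ->
  (forall t, 0 < t -> cabs (F t) <= g t) -> cabs (cint F) <= \int[mu]_(t in D) g t.
Proof.
move=> Fi gi Fg; apply: cabs_le_Re => c.
have [[Fci _] E] := cintZ c Fi; rewrite mulrC -E /= -RintegralZl //.
apply: le_Rintegral => //.
  rewrite (_ : _ \o _ = (fun t => (cabs c)%:E * (EFin \o g) t)%E) //.
  exact: integrableZl.
move=> t; rewrite /= in_itv /= andbT => t0.
rewrite (le_trans (ler_norm _)) // (le_trans (normr_Re_cabs _)) // cabsM mulrC.
by rewrite ler_wpM2l ?cabs_ge0 ?Fg.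
Qed.

Lemma cintegrable_dominated F g : mu.-integrable D (EFin \o g) ->
  measurable_fun D (fun t => complex.Re (F t)) ->
  measurable_fun D (fun t => complex.Im (F t)) ->
  (forall t, 0 < t -> cabs (F t) <= g t) -> cintegrable F.
Proof.
move=> gi m1 m2 Fg; split.
  apply: (integrable_dominated m1) gi => t; rewrite /= in_itv /= andbT => t0.
  exact: le_trans (normr_Re_cabs _) (Fg t t0).
apply: (integrable_dominated m2) gi => t; rewrite /= in_itv /= andbT => t0.
exact: le_trans (normr_Im_cabs _) (Fg t t0).
Qed.

End ComplexIntegral.

(** * The logarithmic moments of Euler's integral *)

Section GammaMoments.
Variable R : realType.
Local Open Scope classical_set_scope.
Local Notation C := (complex R).
Local Notation mu := (@lebesgue_measure R).
Local Notation D := (`]0, +oo[ : set R).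
Implicit Types (z h : C) (s t eta : R).

(** A majorant of the [j]-th moment integrands with abscissa within [eta] of [s],
    integrable as soon as [eta < s]. *)
Definition gmajorant eta j s t := gwt s t * (`|ln t| ^+ j * expR (eta * `|ln t|)).

Lemma exprn_le_expR (u : R) j : 0 <= u -> u ^+ j <= j`!%:R * expR u.
Proof.
move=> u0; case: j => [|j]; first by rewrite expr0 mul1r -expR0 ler_expR.
have := expR_ge1Dxn j u0; rewrite -ler_pdivrMl ?ltr0n ?fact_gt0 // [_^-1 * _]mulrC.
by apply: le_trans; rewrite lerDr.
Qed.

Lemma gwt_abs_ln_le eta s t : 0 <= eta ->
  gwt s t * expR (eta * `|ln t|) <= gwt (s + eta) t + gwt (s - eta) t.
Proof.
move=> e0; have [l0|l0] := ger0P (ln t).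
  rewrite (_ : _ * _ = gwt (s + eta) t) ?lerDl ?gwt_ge0 //.
  by rewrite gwtD ?mulrN ?mulNr.
rewrite (_ : _ * _ = gwt (s - eta) t) ?lerDr ?gwt_ge0 //.
by rewrite gwtD ?mulrN ?mulNr.
Qed.

Let mln : measurable_fun D (@ln R). Proof. exact: measurable_funTS. Qed.

Let measurable_expR_comp (f : R -> R) : measurable_fun D f ->
  measurable_fun D (fun t => expR (f t)).
Proof. by move=> mf; apply: measurableT_comp. Qed.

Let measurable_scale_ln c : measurable_fun D (fun t => c * ln t).
Proof. exact: measurable_funM. Qed.

Lemma measurable_gwt s : measurable_fun D (gwt s).
Proof.
apply: measurable_funM; apply: measurable_expR_comp; last exact: measurable_scale_ln.
exact: measurable_funTS.
Qed.

Lemma gmajorant_ge0 eta j s t : 0 <= gmajorant eta j s t.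
Proof. by rewrite mulr_ge0 ?gwt_ge0 // mulr_ge0 ?exprn_ge0 ?expR_ge0. Qed.

Lemma gmajorant_integrable eta j s : 0 <= eta < s ->
  mu.-integrable D (EFin \o gmajorant eta j s).
Proof.
move=> /andP[eta0 etas]; pose d := (s - eta) / 2; pose eta' := eta + d.
have d0 : 0 < d by rewrite divr_gt0 // subr_gt0.
pose C := j`!%:R / d ^+ j.
have C0 : 0 <= C by rewrite divr_ge0 // exprn_ge0 // ltW.
apply: (@integrable_dominated _ _ (fun t => C * (gwt (s + eta') t + gwt (s - eta') t))).
- apply: measurable_funM; first exact: measurable_gwt.
  have mabs : measurable_fun D (fun t => `|ln t|) by apply: measurableT_comp.
  apply: measurable_funM; first exact: measurable_funX.
  by apply: measurable_expR_comp; exact: measurable_funM.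
- move=> t _; rewrite ger0_norm ?gmajorant_ge0 //.
  have := gwt_abs_ln_le s t (_ : 0 <= eta'); rewrite addr_ge0 // ?(ltW d0) // => /(_ isT).
  move=> h; apply: le_trans (ler_wpM2l C0 h).
  rewrite mulrCA /gmajorant ler_wpM2l ?gwt_ge0 //.
  have -> : eta' * `|ln t| = d * `|ln t| + eta * `|ln t| by rewrite /eta'; ring.
  rewrite expRD mulrA ler_wpM2r ?expR_ge0 // /C mulrAC ler_pdivlMr ?exprn_gt0 //.
  rewrite -exprMn [`|_| * d]mulrC; apply: exprn_le_expR.
  by apply: mulr_ge0; [exact: ltW|exact: normr_ge0].
- rewrite (_ : _ \o _ = (fun t => C%:E * ((gwt (s + eta') t)%:E + (gwt (s - eta') t)%:E))%E) //.
  apply: integrableZl => //; apply: integrableD => //; apply: gwt_integrable.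
    by rewrite /eta'; lra.
  by rewrite /eta' /d; lra.
Qed.

(** The integrand [expR (- t) * t ^ (z - 1) * (ln t) ^ j] and its integral, which
    is the [j]-th complex derivative of Euler's integral. *)
Definition gterm j z t : C := gamma_integrand z t * (ln t)%:C%C ^+ j.
Definition gmoment j z : C := cint (gterm j z).

Lemma cabs_gterm j z t : cabs (gterm j z t) = gwt (complex.Re z) t * `|ln t| ^+ j.
Proof.
rewrite /gterm cabsM cabsX cabs_real /gamma_integrand cabsM cabs_real cabs_cexp.
by rewrite ger0_norm ?expR_ge0 // cReM /= mulr0 subr0 cReB.
Qed.

Lemma gtermD j z h t : gterm j (z + h) t = gterm j z t * cexp (h * (ln t)%:C%C).
Proof.
rewrite /gterm /gamma_integrand (_ : z + h - 1 = z - 1 + h); last by ring.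
by rewrite mulrDl cexpD; ring.
Qed.

Lemma gterm_addn j m z t : gterm (j + m) z t = gterm j z t * (ln t)%:C%C ^+ m.
Proof. by rewrite /gterm exprD mulrA. Qed.

Lemma gtermE j z t : gterm j z t =
  ((gwt (complex.Re z) t * ln t ^+ j * cos (complex.Im z * ln t)) +i*
   (gwt (complex.Re z) t * ln t ^+ j * sin (complex.Im z * ln t)))%C.
Proof.
rewrite /gterm /gamma_integrand -rmorphXn /=; apply/eqP; rewrite eq_complex.
rewrite !(cReM, cImM, cReB, cImB, cReD, cImD) /= /gwt.
rewrite !(cReM, cImM, cReB, cImB) /= !(mulr0, mul0r, subr0, add0r, addr0, oppr0).
by apply/andP; split; apply/eqP; ring.
Qed.

Lemma cintegrable_gterm j z : 0 < complex.Re z -> cintegrable (gterm j z).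
Proof.
move=> z0; have m (f : R -> R) : measurable_fun setT f -> measurable_fun D (fun t =>
    gwt (complex.Re z) t * ln t ^+ j * f (complex.Im z * ln t)).
  move=> mf; apply: measurable_funM.
    by apply: measurable_funM; [exact: measurable_gwt|exact: measurable_funX].
  by apply: measurableT_comp => //; exact: measurable_scale_ln.
apply: (cintegrable_dominated (gmajorant_integrable (eta := 0) j _)).
- by rewrite lexx; exact: z0.
- rewrite (_ : (fun t => _) = (fun t =>
      gwt (complex.Re z) t * ln t ^+ j * cos (complex.Im z * ln t))).
    by apply: m; apply: continuous_measurable_fun; exact: continuous_cos.
  by apply/funext => t; rewrite gtermE.
- rewrite (_ : (fun t => _) = (fun t =>
      gwt (complex.Re z) t * ln t ^+ j * sin (complex.Im z * ln t))).
    by apply: m; apply: continuous_measurable_fun; exact: continuous_sin.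
  by apply/funext => t; rewrite gtermE.
- by move=> t _; rewrite cabs_gterm /gmajorant mul0r expR0 mulr1.
Qed.

(** Taylor expansion of the moments, with an explicit geometric remainder. For
    [M = 2] and small [r] this is complex differentiability; for a fixed [r < 1]
    it is convergence of the Taylor series. *)
Lemma gmoment_taylor (r eta : R) j M z h : 0 < r <= 1 -> 0 <= eta < complex.Re z ->
  cabs h <= r * eta ->
  cabs (gmoment j (z + h) - \sum_(m < M) gmoment (j + m) z * (h ^+ m / m`!%:R)) <=
  r ^+ M * \int[mu]_(t in D) gmajorant eta j (complex.Re z) t.
Proof.
move=> /[dup] r01 /andP[r0 r1] /[dup] etaz /andP[eta0 etaz'] hr.
have z0 : 0 < complex.Re z by exact: le_lt_trans etaz'.
have zh0 : 0 < complex.Re (z + h).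
  have h1 : `|complex.Re h| <= eta.
    by rewrite (le_trans (normr_Re_cabs h)) // (le_trans hr) // ler_piMl.
  by rewrite cReD; move: h1; rewrite ler_norml; lra.
have gi m : cintegrable (fun t => gterm (j + m) z t * (h ^+ m / m`!%:R)).
  by have [] := cintZ (h ^+ m / m`!%:R) (cintegrable_gterm (j + m) z0).
have [sumi sumE] := cint_sum M gi.
have [negi negE] := cintZ (- 1) sumi.
have [difi difE] := cintD (cintegrable_gterm j zh0) negi.
rewrite (_ : _ - _ = cint (fun t => gterm j (z + h) t +
    (\sum_(m < M) gterm (j + m) z t * (h ^+ m / m`!%:R)) * -1)); last first.
  rewrite difE negE sumE mulrN1; congr (_ - _); apply: eq_bigr => m _.
  by have [_ ->] := cintZ (h ^+ m / m`!%:R) (cintegrable_gterm (j + m) z0).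
have mi := gmajorant_integrable j etaz.
rewrite -RintegralZl //.
apply: cabs_cint_le => //.
  rewrite (_ : _ \o _ = (fun t => (r ^+ M)%:E * (EFin \o gmajorant eta j (complex.Re z)) t)%E) //.
  exact: integrableZl.
move=> t t0.
have -> : gterm j (z + h) t + (\sum_(m < M) gterm (j + m) z t * (h ^+ m / m`!%:R)) * -1 =
    gterm j z t * (cexp (h * (ln t)%:C%C) - \sum_(m < M) (h * (ln t)%:C%C) ^+ m / m`!%:R).
  rewrite mulrN1 mulrBr gtermD mulr_sumr; congr (_ - _); apply: eq_bigr => m _.
  by rewrite gterm_addn exprMn; ring.
rewrite cabsM cabs_gterm /gmajorant.
rewrite mulrCA -mulrA ler_wpM2l ?gwt_ge0 // mulrCA ler_wpM2l ?exprn_ge0 //.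
apply: le_trans (cexp_remainder M _ r01) _.
rewrite ler_wpM2l ?exprn_ge0 ?(ltW r0) // ler_expR cabsM cabs_real.
by rewrite ler_pdivrMr // mulrAC ler_wpM2r // mulrC.
Qed.

End GammaMoments.

(** * Complex derivatives of the gamma function *)

Section GammaDerivatives.
Variable R : realType.
Local Open Scope classical_set_scope.
Local Notation C := (complex R).
Local Notation mu := (@lebesgue_measure R).
Local Notation D := (`]0, +oo[ : set R).
(* The complex numbers receive their topology as a numeric field. *)
Let K : numFieldType := C.
Implicit Types (z h : C).

Lemma cGammaE z : 0 < complex.Re z -> cGamma z = gmoment 0 z.
Proof.
move=> z0; rewrite /cGamma z0 big_ord0 divr1 addr0 /gmoment /cint /euler_integral.
by congr (_ +i* _)%C; apply: eq_Rintegral => t _; rewrite /gterm expr0 mulr1.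
Qed.

Lemma gmoment_quotient j z : 0 < complex.Re z ->
  h^-1 * (gmoment j (h + z) - gmoment j z) @[h --> (0 : K)^'] --> (gmoment j.+1 z : K^o).
Proof.
move=> z0; pose eta := complex.Re z / 2.
have eta0 : 0 < eta by rewrite divr_gt0.
pose I := \int[mu]_(t in D) gmajorant eta j (complex.Re z) t.
have I0 : 0 <= I by apply: Rintegral_ge0 => t _; exact: gmajorant_ge0.
apply: (proj2 (@cvgrPdist_le K K^o _ _ _ _ _)) => e e0.
have eR : e = (complex.Re e)%:C%C by rewrite RRe_real // gtr0_real.
have {}e0 : 0 < complex.Re e by move: e0; rewrite {1}eR (ltcR 0).
set e' := complex.Re e in eR e0.
pose d := e' * eta ^+ 2 / (I + 1).
have d0 : 0 < d by rewrite divr_gt0 ?mulr_gt0 ?exprn_gt0 // ltr_wpDl.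
have eta0C : 0 < eta%:C%C :> K by rewrite (ltcR 0).
have d0C : 0 < d%:C%C :> K by rewrite (ltcR 0).
near=> h.
have h0 : (h : K) != 0 by near: h; exact: (@nbhs_dnbhs_neq K).
have h_eta : `|(h : K)| <= (eta%:C%C : K) by near: h; exact: (@dnbhs0_le K K^o).
have {}h_eta : cabs h <= eta by rewrite -lecR.
have h_d : `|(h : K)| <= (d%:C%C : K) by near: h; exact: (@dnbhs0_le K K^o).
have {}h_d : cabs h <= d by rewrite -lecR.
have hgt0 : 0 < cabs h by rewrite cabs_gt0.
rewrite eR [`|_|](_ : _ =
  (cabs (gmoment j.+1 z - h^-1 * (gmoment j (h + z) - gmoment j z)))%:C%C) //.
rewrite lecR -(ler_pM2l hgt0) -cabsM.
(* The ratio [|h| / eta] makes the second-order remainder quadratic in [h]. *)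
have T := @gmoment_taylor R (cabs h / eta) eta j 2 z h.
rewrite !big_ord_recl big_ord0 /= expr0 expr1 !divr1 mulr1 addr0 addn0 addn1 in T.
rewrite divfK ?gt_eqF // in T.
have {}T := T (_ : _) (_ : _) (lexx _).
rewrite -cabsN (_ : - _ = gmoment j (z + h) - (gmoment j z + gmoment j.+1 z * h)); last first.
  by rewrite [z + h]addrC; field.
apply: le_trans (T _ _) _.
- by rewrite divr_gt0 //= ler_pdivrMr // mul1r.
- by rewrite ltW //= /eta; lra.
rewrite -/I expr_div_n mulrAC ler_pdivrMr ?exprn_gt0 // expr2 -!mulrA.
rewrite ler_wpM2l ?cabs_ge0 //.
apply: (@le_trans _ _ (d * (I + 1))); last by rewrite /d divfK // gt_eqF // ltr_wpDl.
by apply: ler_pM; rewrite ?cabs_ge0 // lerDl.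
Unshelve. all: by end_near. Qed.

Lemma cderiv_cGamma j z : 0 < complex.Re z -> cderiv (@cGamma R) j z = gmoment j z.
Proof.
elim: j z => [|j IH] z z0; first by rewrite /cderiv derive1n0 cGammaE.
rewrite /cderiv derive1nS /derive1; apply: (@cvg_lim K^o); first exact: norm_hausdorff.
apply: cvg_trans (@gmoment_quotient j z z0); apply: near_eq_cvg.
have z0C : 0 < (complex.Re z)%:C%C :> K by rewrite (ltcR 0).
near=> h.
have hz : `|(h : K)| < ((complex.Re z)%:C%C : K) by near: h; exact: (@dnbhs0_lt K K^o).
have {}hz : cabs h < complex.Re z by rewrite -ltcR.
have hz0 : 0 < complex.Re (h + z).
  by rewrite cReD; move: (le_lt_trans (normr_Re_cabs h) hz); rewrite ltr_norml; lra.
by rewrite -!IH.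
Unshelve. all: by end_near. Qed.

(** On the positive axis the first moment is a real integral. *)
Lemma Gamma1E (x : R) : 0 < x -> Gamma1 x = \int[mu]_(t in D) (gwt x t * ln t).
Proof.
move=> x0; rewrite /Gamma1 cderiv_cGamma //.
transitivity (\int[mu]_(t in D) complex.Re (gterm 1 x%:C%C t)) => //.
by apply: eq_Rintegral => t _; rewrite gtermE /= mul0r cos0 mulr1 expr1.
Qed.

End GammaDerivatives.

(** * The scalar bound *)

Section ScalarBound.
Variable R : realType.
Local Open Scope classical_set_scope.
Local Notation C := (complex R).
Local Notation mu := (@lebesgue_measure R).
Local Notation D := (`]0, +oo[ : set R).
Implicit Types (z : C) (a r x t : R).

Lemma sum_le_integral N (u : nat -> R) (f : nat -> R -> R) :
  (forall k, mu.-integrable D (EFin \o f k)) ->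
  (forall k, u k <= \int[mu]_(t in D) f k t) ->
  mu.-integrable D (EFin \o (fun t => \sum_(k < N) f k t)) /\
  \sum_(k < N) u k <= \int[mu]_(t in D) \sum_(k < N) f k t.
Proof.
move=> fi uf; elim: N => [|N [IH1 IH2]].
  rewrite big_ord0 (_ : (fun t => _) = fun=> 0); last by apply/funext => t; rewrite big_ord0.
  by split; [exact: integrable0|rewrite Rintegral_ge0].
rewrite big_ord_recr (_ : (fun t => _) = (fun t => \sum_(k < N) f k t + f N t)); last first.
  by apply/funext => t; rewrite big_ord_recr.
split.
  rewrite (_ : _ \o _ = ((EFin \o (fun t => \sum_(k < N) f k t)%R) \+ (EFin \o f N))%E) //.
  exact: integrableD.
by rewrite RintegralD //=; apply: lerD.
Qed.

Lemma sum_exprS_le_expR N (u : R) : 0 <= u ->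
  \sum_(k < N) u ^+ k.+1 / k.+1`!%:R <= u * expR u.
Proof.
move=> u0.
have le_expR M : \sum_(k < M) u ^+ k / k`!%:R <= expR u.
  rewrite (_ : \sum_(k < M) _ = series (exp_coeff u) M); last first.
    by rewrite /series /= big_mkord.
  rewrite /expR; apply: nondecreasing_cvgn_le; last exact: is_cvg_series_exp_coeff.
  by apply: nondecreasing_series => n _ _; exact: exp_coeff_ge0.
apply: le_trans (ler_wpM2l u0 (le_expR N)); rewrite mulr_sumr; apply: ler_sum => k _.
rewrite exprS -mulrA ler_wpM2l // ler_wpM2l ?exprn_ge0 //.
by rewrite lef_pV2 ?posrE ?ltr0n ?fact_gt0 // ler_nat factS leq_pmull.
Qed.

(* A majorant split at [t = 1] according to the sign of the logarithm; on the
   unit interval the integrand of the derivative of the gamma function at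
   [a + r] is negative, and the logarithmic majorant at [a + r] compensates it. *)
Let split_majorant a r t := gwt (a + r) t * ln t +
  ((fun t => log_majorant (a + r) t + log_majorant (a - r) t) \_ `]0, 1]) t.

Let gmajorant_le_split a r t : 0 < t -> gmajorant r 1 a t <= split_majorant a r t.
Proof.
move=> t0; rewrite /gmajorant /split_majorant /patch expr1; case: ifPn.
  rewrite inE /= in_itv /= => /andP[_ t1].
  have t01 : 0 < t <= 1 by rewrite t0.
  have := gwt_le_log_majorant (a + r) t01; have := gwt_le_log_majorant (a - r) t01.
  rewrite ler0_norm ?ln_le0 // (_ : gwt a t * _ = gwt (a - r) t * - ln t); first by lra.
  by rewrite gwtD [- r * _]mulNr [r * - _]mulrN; ring.
rewrite notin_setE /= in_itv /= t0 /= => /negP; rewrite -ltNge => t1.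
by rewrite ger0_norm ?ln_ge0 ?(ltW t1) // addr0 gwtD mulrA mulrAC.
Qed.

Lemma integral_gmajorant_le a r : 0 < r < a ->
  \int[mu]_(t in D) gmajorant r 1 a t <=
  Gamma1 (a + r) + log_moment (a + r) + log_moment (a - r).
Proof.
move=> /andP[r0 ra].
have p1 : 0 < a + r by lra.
have p2 : 0 < a - r by lra.
have [i1 b1] := integral_log_majorant p1; have [i2 b2] := integral_log_majorant p2.
pose m t := log_majorant (a + r) t + log_majorant (a - r) t.
have m01 : measurable (`]0, 1] : set R) by exact: measurable_itv.
have mD : measurable D by exact: measurable_pos_reals.
have im : mu.-integrable `]0, 1] (EFin \o m).
  rewrite (_ : _ \o _ = ((EFin \o log_majorant (a + r)) \+ (EFin \o log_majorant (a - r)))%E) //.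
  exact: integrableD.
have DI : D `&` `]0, 1] = `]0, 1].
  by apply/setIidPr => t; rewrite /= !in_itv /= andbT => /andP[].
have iG : mu.-integrable D (EFin \o (fun t => gwt (a + r) t * ln t)).
  have [+ _] := @cintegrable_gterm R 1 (a + r)%:C%C p1.
  by apply: eq_integrable => // t _; rewrite gtermE /= mul0r cos0 mulr1 expr1.
have ip : mu.-integrable D (EFin \o (m \_ `]0, 1])).
  by rewrite -restrict_EFin; apply/integrable_restrict => //; rewrite DI.
apply: (@le_trans _ _ (\int[mu]_(t in D) split_majorant a r t)).
  apply: le_Rintegral => //.
  - by apply: gmajorant_integrable; rewrite ltW.
  - rewrite (_ : _ \o _ = ((EFin \o (fun t => gwt (a + r) t * ln t)%R) \+
        (EFin \o (m \_ `]0, 1])%R))%E) //.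
    exact: integrableD.
  - by move=> t; rewrite /= in_itv /= andbT; exact: gmajorant_le_split.
rewrite RintegralD // -Gamma1E // -Rintegral_mkcondr DI -addrA lerD2l.
by rewrite RintegralD // lerD.
Qed.

Lemma cosh1_gt : 2^-1 < cosh1 R - 1.
Proof.
have h1 : 13 / 8 <= expR (2^-1 : R).
  have := @expR_ge_quadratic R 2^-1; rewrite invr_ge0 => /(_ (ler0n _ _)).
  by apply: le_trans; lra.
have e1 : expR 1 = expR 2^-1 * expR 2^-1 :> R by rewrite -expRD; congr expR; field.
have e0 := expR_gt0 (1 : R).
rewrite /cosh1 expRN; set e := expR 1 in e0 e1 *.
have e2 : 169 / 64 <= e by nra.
suff : 3 < e + e^-1 by lra.
have -> : e + e^-1 = (e ^+ 2 + 1) / e by field; rewrite gt_eqF.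
by rewrite ltr_pdivlMr // expr2; nra.
Qed.

Lemma log_moment_lt_omega x : 0 < x -> log_moment x < omega x.
Proof.
move=> x0; rewrite /omega /log_moment.
have c := cosh1_gt.
have -> : (2 * x + 1) / (x ^+ 2 * (x + 1) ^+ 2) = x ^- 2 - (x + 1) ^- 2.
  by field; rewrite !gt_eqF // addr_gt0.
rewrite ltrD2l ltr_pM2r ?invr_gt0 ?exprn_gt0 ?addr_gt0 //; lra.
Qed.

Lemma delta_gt a r : 0 < r < a ->
  r * \int[mu]_(t in D) gmajorant r 1 a t < delta a r.
Proof.
move=> ra; have := integral_gmajorant_le ra; case/andP: ra => r0 ra.
have := @log_moment_lt_omega (a + r); have := @log_moment_lt_omega (a - r).
rewrite /delta ltr_pM2l //; lra.
Qed.

Lemma sum_gmoment_le N z r : 0 < r < complex.Re z ->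
  \sum_(k < N) cabs (gmoment k.+1 z / k.+1`!%:R) * r ^+ k.+1 <=
  r * \int[mu]_(t in D) gmajorant r 1 (complex.Re z) t.
Proof.
move=> /andP[r0 rz]; have z0 : 0 < complex.Re z by exact: lt_trans rz.
have mD : measurable D by exact: measurable_pos_reals.
pose c k : R := r ^+ k.+1 / k.+1`!%:R.
pose f k t := c k * gmajorant 0 k.+1 (complex.Re z) t.
have c0 k : 0 <= c k by rewrite divr_ge0 // exprn_ge0 // ltW.
have gi k : mu.-integrable D (EFin \o gmajorant 0 k (complex.Re z)).
  by apply: gmajorant_integrable; rewrite lexx z0.
have fi k : mu.-integrable D (EFin \o f k).
  rewrite (_ : _ \o _ = (fun t => (c k)%:E * (EFin \o gmajorant 0 k.+1 (complex.Re z)) t)%E) //.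
  exact: integrableZl.
have gri : mu.-integrable D (EFin \o gmajorant r 1 (complex.Re z)).
  by apply: gmajorant_integrable; rewrite ltW.
have [|si sle] := @sum_le_integral N (fun k => cabs (gmoment k.+1 z / k.+1`!%:R) * r ^+ k.+1) f fi.
  move=> k; rewrite RintegralZl // cabsM mulrAC -mulrA mulrC.
  have -> : cabs ((k.+1`!%:R : C)^-1) = (k.+1`!%:R)^-1.
    by rewrite -(rmorph_nat (real_complex R)) -fmorphV cabs_real ger0_norm ?invr_ge0.
  rewrite -/(c k); apply: ler_wpM2l => //; apply: cabs_cint_le => //.
    exact: cintegrable_gterm.
  by move=> t _; rewrite cabs_gterm /gmajorant mul0r expR0 mulr1.
apply: le_trans sle _; rewrite -RintegralZl //; apply: le_Rintegral => //.
  rewrite (_ : _ \o _ = (fun t => r%:E * (EFin \o gmajorant r 1 (complex.Re z)) t)%E) //.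
  exact: integrableZl.
move=> t _; rewrite /f /gmajorant.
rewrite (eq_bigr (fun k : 'I_N =>
    gwt (complex.Re z) t * ((r * `|ln t|) ^+ k.+1 / k.+1`!%:R))); last first.
  by move=> k _; rewrite mul0r expR0 mulr1 /c exprMn; ring.
rewrite -mulr_sumr mulrCA ler_wpM2l ?gwt_ge0 // expr1 mulrA.
by apply: sum_exprS_le_expR; rewrite mulr_ge0 // ltW.
Qed.

End ScalarBound.

(** * Taylor polynomials of the gamma function at a matrix *)

Section TaylorPolynomial.
Variable R : realType.
Local Notation C := (complex R).

Lemma derivn_XsubC_exp (z : C) k m :
  (('X - z%:P) ^+ m)^`(k) = ('X - z%:P) ^+ (m - k) *+ m ^_ k.
Proof.
elim: k => [|k IH]; first by rewrite subn0.
rewrite derivnS IH derivMn deriv_exp derivXsubC mul1r -mulrnA subnS.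
by rewrite ffactnSr mulnC.
Qed.

(** The Taylor polynomial of the gamma function at [z], of size at most [N]. *)
Definition gtaylor (z : C) N : {poly C} :=
  \sum_(m < N) (gmoment m z / m`!%:R) *: ('X - z%:P) ^+ m.

Lemma derivn_gtaylor z k M y : ((gtaylor z (k + M))^`(k)).[y] =
  \sum_(m < M) gmoment (k + m) z * ((y - z) ^+ m / m`!%:R).
Proof.
rewrite /gtaylor raddf_sum horner_sum big_split_ord /= big1 ?add0r => [|m _].
  apply: eq_bigr => m _.
  rewrite derivnZ hornerZ derivn_XsubC_exp hornerMn horner_exp hornerXsubC addKn.
  have E : (k + m)`!%:R = m`!%:R * ((k + m) ^_ k)%:R :> C.
    by rewrite -natrM -(ffact_fact (leq_addr m k)) addKn mulnC.
  have f0 n : n`!%:R != 0 :> C by rewrite pnatr_eq0 -lt0n fact_gt0.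
  have ff0 : ((k + m) ^_ k)%:R != 0 :> C by rewrite pnatr_eq0 -lt0n ffact_gt0 leq_addr.
  by rewrite -[_ *+ _]mulr_natr E; field; rewrite f0 ff0.
by rewrite derivnZ hornerZ derivn_XsubC_exp ffact_small ?mulr0n ?horner0 ?mulr0 //= ltn_ord.
Qed.

(** An inequality that holds up to every term of a vanishing geometric sequence
    holds. *)
Lemma geometric_le (rho u v K : R) : 0 <= rho < 1 ->
  (forall M, u <= v + rho ^+ M * K) -> u <= v.
Proof.
move=> /andP[rho0 rho1] H.
have cv : (v + rho ^+ M * K @[M --> \oo] --> v + 0 * K)%classic.
  apply: cvgD; first exact: cvg_cst.
  by apply: cvgMl; apply: cvg_expr; rewrite ger0_norm.
rewrite -[v]addr0 -(mul0r K) -(cvg_lim _ cv) //.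
apply: limr_ge; first by apply/cvg_ex; exists (v + 0 * K).
by apply: nearW.
Qed.

End TaylorPolynomial.

Section MatrixGamma.
Variables (R : realType) (p : option nat) (n : nat).
Local Notation C := (complex R).
Variables (lambda : C) (Q : 'M[C]_n.+1) (r : R).
Hypothesis hp : p <> Some 0%N.
Hypothesis hr : 0 < r < complex.Re lambda.
Hypothesis hQ : forall x, vnorm p (Q *m x) <= r * vnorm p x.
Let A := lambda%:M + Q.

(** Eigenvectors are row vectors whereas the norms act on columns; transposing
    the singular matrix [A - y] links the two. *)
Lemma eigenvalue_bound y : root (mxminpoly A) y -> cabs (y - lambda) <= r.
Proof.
rewrite -eigenvalue_root_min => /eigenvalueP [u uA u0].
have /det0P [v v0] : \det (A - y%:M)^T == 0.
  by rewrite det_tr; apply/det0P; exists u => //; rewrite mulmxBr uA mul_mx_scalar subrr.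
move=> /(congr1 trmx); rewrite trmx_mul trmxK trmx0 mulmxBl mul_scalar_mx.
pose x := v^T; have x0 : 0 < vnorm p x.
  by rewrite vnorm_gt0 //; apply: contraNneq v0 => /(congr1 trmx); rewrite trmxK trmx0 => ->.
rewrite -/x => /eqP; rewrite subr_eq0 => /eqP.
rewrite mulmxDl mul_scalar_mx => /(canRL (addKr _)); rewrite -scaleNr -scalerDl addrC => Qx.
by have := hQ x; rewrite Qx vnormZ // ler_pM2r.
Qed.

Lemma vnorm_powers k x : vnorm p (Q ^+ k *m x) <= r ^+ k * vnorm p x.
Proof.
have r0 : 0 <= r by case/andP: hr => /ltW.
elim: k => [|k IH]; first by rewrite !expr0 mul1mx mul1r.
rewrite !exprS -mulmxA (le_trans (hQ _)) // -mulrA ler_wpM2l //.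
Qed.

Lemma horner_mx_gtaylor N : horner_mx A (gtaylor lambda N) =
  \sum_(k < N) (gmoment k lambda / k`!%:R) *: Q ^+ k.
Proof.
rewrite /gtaylor rmorph_sum /=; apply: eq_bigr => k _.
rewrite -mul_polyC rmorphM /= horner_mx_C -mul_scalar_mx rmorphXn rmorphB /=.
by rewrite horner_mx_X horner_mx_C /A addrC addKr.
Qed.

(** The spectrum lies in a compact part of the disc of convergence, where the
    derivatives of the Taylor polynomials converge geometrically. *)
Lemma mxGamma_le (B : R) x :
  (forall N, vnorm p ((horner_mx A (gtaylor lambda N.+1) - (gmoment 0 lambda)%:M) *m x)
     <= B) ->
  vnorm p ((mxGamma A - (gmoment 0 lambda)%:M) *m x) <= B.
Proof.
move=> HB; have /andP[r0 ra] := hr.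
have [rs rsE] := closed_field_poly_normal (mxminpoly A).
have {}rsE : mxminpoly A = \prod_(z <- rs) ('X - z%:P).
  by rewrite rsE (monicP (mxminpoly_monic A)) scale1r.
have mupE y : mup y (mxminpoly A) = count_mem y rs by rewrite rsE mup_prod_XsubC.
rewrite /mxGamma /primary_matrix_function.
case: xgetP => [q _ [_ qE]|]; last first.
  have [q sq qE] := hermite_exists rs (fun x j => cderiv (@cGamma R) j x).
  move=> /(_ q); case; split; first by rewrite rsE size_prod_XsubC ltnS.
  by move=> y j; rewrite mupE; exact: qE.
have [H HE] := hermite_basis rs.
have PA : horner_mx A (\prod_(z <- rs) ('X - z%:P)) = 0 by rewrite -rsE mx_root_minpoly.
(* Any [eta] strictly between [r] and the real part of [lambda] would do. *)
pose eta := (r + complex.Re lambda) / 2; pose rho := r / eta.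
have eta0 : 0 < eta by rewrite /eta; lra.
have reta : r < eta by rewrite /eta; lra.
have rho0 : 0 < rho by rewrite divr_gt0.
have rho1 : rho < 1 by rewrite ltr_pdivrMr // mul1r.
pose I k := \int[lebesgue_measure]_(t in `]0, +oo[) gmajorant eta k (complex.Re lambda) t.
have I0 k : 0 <= I k by apply: Rintegral_ge0 => t _; exact: gmajorant_ge0.
pose S := size rs.
pose K := \sum_(y <- undup rs) \sum_(k < count_mem y rs) I k * vnorm p (horner_mx A (H y k) *m x).
apply: (@geometric_le R rho _ _ K) => [|M]; first by rewrite ltW.
(* Differentiating at most [S] times still leaves [M] terms of the expansion. *)
pose N := (S + M)%N.
rewrite (_ : _ *m x = (horner_mx A (gtaylor lambda N.+1) - (gmoment 0 lambda)%:M) *m x +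
    horner_mx A (q - gtaylor lambda N.+1) *m x); last first.
  by rewrite -mulmxDl; congr (_ *m _); rewrite rmorphB /= [RHS]addrC addrA subrK.
apply: le_trans (vnormD hp _ _) _; apply: lerD; first exact: HB.
rewrite (horner_mx_hermite _ PA HE) mulmx_suml.
apply: le_trans (vnorm_sum hp _ _ _) _.
rewrite mulr_sumr big_seq [leRHS]big_seq; apply: ler_sum => y.
rewrite mem_undup => yrs; rewrite mulmx_suml.
apply: le_trans (vnorm_sum hp _ _ _) _.
rewrite mulr_sumr; apply: ler_sum => k _.
rewrite -scalemxAl vnormZ // mulrA ler_wpM2r ?vnorm_ge0 //.
have kS : (k <= S)%N by rewrite ltnW // (leq_trans (ltn_ord k)) // count_size.
have yl : cabs (y - lambda) <= r.
  by apply: eigenvalue_bound; rewrite rsE root_prod_XsubC.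
have y0 : 0 < complex.Re y.
  have := le_trans (normr_Re_cabs (y - lambda)) yl.
  by rewrite cReB ler_norml; lra.
rewrite derivnB hornerD hornerN qE ?mupE // cderiv_cGamma //.
pose M' := (S - k + M).+1.
have -> : N.+1 = (k + M')%N by rewrite /N /M' addnS addnA subnKC.
rewrite derivn_gtaylor.
have := @gmoment_taylor R rho eta k M' lambda (y - lambda).
rewrite [lambda + _]addrC subrK rho0 ltW //= => /(_ isT) T.
apply: le_trans (T _ _) _; first by rewrite ltW //= /eta; lra.
  by rewrite /rho divfK // gt_eqF.
rewrite ler_wpM2r ?I0 // ler_wiXn2l ?(ltW rho0) ?(ltW rho1) //.
by rewrite /M' leqW // leq_addl.
Qed.

Lemma opnorm_mxGamma_le :
  opnorm p (mxGamma A - (gmoment 0 lambda)%:M) <=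
  r * \int[lebesgue_measure]_(t in `]0, +oo[) gmajorant r 1 (complex.Re lambda) t.
Proof.
apply: opnorm_le => // x; apply: mxGamma_le => N.
rewrite horner_mx_gtaylor big_ord_recl expr0 fact0 divr1 scalemx1 addrC addKr.
rewrite mulmx_suml; apply: le_trans (vnorm_sum hp _ _ _) _.
apply: le_trans (ler_wpM2r (vnorm_ge0 _ _) (sum_gmoment_le N hr)).
rewrite mulr_suml; apply: ler_sum => k _.
rewrite -scalemxAl vnormZ // -mulrA ler_wpM2l ?cabs_ge0 //.
exact: vnorm_powers.
Qed.

End MatrixGamma.

(** At a scalar matrix every Taylor polynomial centred at the scalar is already
    constant; any norm serves to see it. *)
Lemma mxGamma_scalar (R : realType) n (lambda : complex R) : 0 < complex.Re lambda ->
  @mxGamma R n lambda%:M = (gmoment 0 lambda)%:M.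
Proof.
move=> l0; pose r := complex.Re lambda / 2.
have hr : 0 < r < complex.Re lambda by rewrite /r; lra.
have h0 (x : 'cV[complex R]_n.+1) : vnorm None ((0 : 'M[complex R]_n.+1) *m x) <= r * vnorm None x.
  by rewrite mul0mx vnorm0 // mulr_ge0 ?vnorm_ge0 // ltW //; case/andP: hr.
apply/eqP; rewrite -subr_eq0; apply/eqP/matrixP => i j.
pose x := delta_mx j 0 : 'cV[complex R]_n.+1.
have hp : None <> Some 0%N by [].
have := @mxGamma_le R None n lambda 0 r hp hr h0 0 x _.
rewrite addr0 => H.
have {}H : vnorm None ((mxGamma lambda%:M - (gmoment 0 lambda)%:M) *m x) <= 0.
  apply: H => N; have := @horner_mx_gtaylor R n lambda 0 N.+1; rewrite addr0 => ->.
  rewrite big_ord_recl big1 ?addr0 => [|k _]; last by rewrite expr0n scaler0.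
  by rewrite expr0 fact0 divr1 scalemx1 subrr mul0mx vnorm0.
have := le_trans (cabs_le_vnorm hp _ i) H.
rewrite -colE mxE le_eqVlt ltNge cabs_ge0 orbF cabs_eq0 => /eqP ->.
by rewrite mxE.
Qed.

Theorem theorem4p3 (R : realType) (p : option nat) (n : nat)
    (lambda : complex R) (Q : 'M[complex R]_n.+1) (Rad : 'M[R]_n.+1)
    (hp : p <> Some 0%N)
    (hRad : forall i j, 0 <= Rad i j)
    (hRad0 : Rad <> 0)
    (hlam : 0 < complex.Re lambda - opnormR p Rad)
    (hQ : forall i j, cabs (Q i j) <= Rad i j) :
  opnorm p (mxGamma (lambda%:M + Q) - mxGamma lambda%:M)
    < delta (complex.Re lambda) (opnormR p Rad).
Proof.
have r0 := opnormR_gt0 hp hRad0.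
have hr : 0 < opnormR p Rad < complex.Re lambda by rewrite r0 -subr_gt0.
rewrite mxGamma_scalar; last by lra.
apply: le_lt_trans (delta_gt hr); apply: opnorm_mxGamma_le => // x.
exact: vnorm_dominated.
Qed.
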